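(* Let $(G,d,\mathcal{H})$ be a metric measure graph. Let $\mathbb{P}\in\mathcal{W}_2(\mathcal{W}_2(G))$ be such that $\mathbb{P}(\mathcal{W}_2^{ac}(G))>0$, where $\mathcal{W}_2^{ac}(G)$ is the set of measures in $\mathcal{W}_2(G)$ that are absolutely continuous with respect to $\mathcal{H}$. If $\mu_{\mathbb{P}}\in\mathcal{W}_2(G)$ is a barycenter of $\mathbb{P}$, then the restriction of $\mu_{\mathbb{P}}$ to the interior of any given edge is absolutely continuous with respect to $\mathcal{H}$. Therefore, if $\mu_{\mathbb{P}}$ is not absolutely continuous, then its singular part is a sum of (weighted) Dirac measures located at vertices of $G$.
   Context: Metric measure graph. Let $(V,\mathcal{E})$ be a graph: $V$ is an at most countable set of vertices and $\mathcal{E}\subset\{\{x,y\}: x,y\in V, x\ne y\}$ is the set of edges (so there are no loops and no multiple edges). It is assumed connected, with every vertex of finite degree at least $1$. A length function is a map $l:\mathcal{E}\to[0,\infty)$ with $\inf_{e\in\mathcal{E}} l(e)>0$. Each edge $e$, given an orientation $(e_0,e_1)$ of its endpoints, is identified with $[0,l(e)]$, with $e_0$ identified with $0$ and $e_1$ with $l(e)$. The metric graph $G$ is the quotient of the disjoint union of the segments $[0,l(e)]$ (one for each edge), where points representing the same vertex are identified. The interior of the edge $e$ is the open interval $]0,l(e)[$. The distance $d(x,y)$ is the infimum of the lengths of paths in $G$ from $x$ to $y$, a path being a finite concatenation of segments of edges and its length the sum of the lengths of these segments. $\mathcal{H}$ is the one-dimensional Hausdorff measure of $(G,d)$; it gives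 no mass to $V$ and coincides with the Lebesgue measure on each edge $[0,l(e)]$. Wasserstein space. For a metric space $(X,d)$, $\mathcal{W}_2(X)$ is the set of Borel probability measures $\mu$ on $X$ with $\int d^2(x_0,x)\,d\mu(x)<\infty$ for some (any) $x_0\in X$, with the distance $d_W(\mu,\nu)=\left(\min_{\pi}\int_{X\times X} d^2(x,y)\,d\pi(x,y)\right)^{1/2}$, the minimum being over probability measures $\pi$ on $X\times X$ with marginals $\mu,\nu$. $\mathcal{W}_2(\mathcal{W}_2(X))$ is the same construction applied to the metric space $(\mathcal{W}_2(X),d_W)$. Barycenter. A barycenter of $\mathbb{P}\in\mathcal{W}_2(\mathcal{W}_2(X))$ is a measure in $\mathcal{W}_2(X)$ that minimizes $\mu\mapsto\int_{\mathcal{W}_2(X)} d_W(\mu,\nu)^2\,d\mathbb{P}(\nu)$ over $\mathcal{W}_2(X)$. *)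

(* Defs.v *)
From HB Require Import structures.
From mathcomp Require Import all_boot all_order all_algebra finmap.
From mathcomp Require Import generic_quotient.
From mathcomp Require Import all_classical all_reals all_analysis.
From mathcomp Require Import measurable_realfun lra.

Set Implicit Arguments.
Unset Strict Implicit.
Unset Printing Implicit Defensive.

Import Order.TTheory GRing.Theory Num.Theory.
Import numFieldNormedType.Exports.

Local Open Scope classical_set_scope.
Local Open Scope ring_scope.
Local Open Scope quotient_scope.

#[short(type="pmetricType")]
HB.structure Definition PointedMetric (R : numDomainType) :=
  { M of Pointed M & Metric R M }.

Local Ltac min_lra :=
  repeat match goal with |- context [Order.min ?a ?b] =>
    lazymatch constr:((a, b)) with
    | context [Order.min _ _] => fail
    | _ => case: (leP a b) => ?
    end
  end; lra.

(* [graph_base] only says that the graph is nonempty: the measurable types of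
   the library are pointed.  [org] and [dst] give the chosen orientation. *)
Record metric_graph (R : realType) (V : countType) := MetricGraph {
  edges : set {fset V} ;
  org : edges -> V ;
  dst : edges -> V ;
  len : edges -> R ;
  graph_base : V ;
  edge_card : forall e, edges e -> #|` e| = 2%N ;
  edge_ends : forall e : edges, val e = [fset org e; dst e]%fset ;
  graph_degree : forall v, finite_set [set e | edges e /\ v \in e] /\
                           [set e | edges e /\ v \in e] !=set0 ;
  graph_connected : forall u v, exists p : seq V,
    path (fun x y => [fset x; y]%fset \in edges) u p /\ last u p = v ;
  len_ge0 : forall e, 0 <= len e ;
  len_inf_gt0 : 0 < inf (range len)
}.

Section metric_graph_space.
Context (R : realType) (V : countType) (Gr : metric_graph R V).
Implicit Types e : edges Gr.

Definition segment e : Type := set_type [set` `[0, len e]].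

Definition prepoint : Type := {e : edges Gr & segment e}.

HB.instance Definition _ := Choice.on prepoint.

Definition position (p : prepoint) : R := val (tagged p).

Definition at_vertex (p : prepoint) : option V :=
  if position p == 0 then Some (org (tag p))
  else if position p == len (tag p) then Some (dst (tag p))
  else None.

Definition glue (p q : prepoint) : bool :=
  (p == q) || (at_vertex p && (at_vertex p == at_vertex q)).

Lemma glue_refl : reflexive glue.
Proof. by move=> p; rewrite /glue eqxx. Qed.

Lemma glue_sym : symmetric glue.
Proof.
move=> p q; rewrite /glue (eq_sym p) [at_vertex q == _]eq_sym.
by have [->|_] := eqVneq (at_vertex p) (at_vertex q); rewrite ?andbF.
Qed.

Lemma glue_trans : transitive glue.
Proof.
move=> q p r; rewrite /glue => /orP[/eqP->//|/andP[vp /eqP pq]].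
move=> /orP[/eqP<-|/andP[_ /eqP qr]]; apply/orP; right.
  by rewrite vp pq eqxx.
by rewrite vp pq qr eqxx.
Qed.

Definition glue_equiv : equiv_rel prepoint :=
  EquivRel glue glue_refl glue_sym glue_trans.

Definition mgspace : Type := {eq_quot glue_equiv}.

HB.instance Definition _ := Choice.on mgspace.
HB.instance Definition _ := EqQuotient.on mgspace.

Definition pt e (s : segment e) : mgspace :=
  (\pi_mgspace (Tagged segment s)).

Definition vertices : set mgspace :=
  [set x | exists2 p : prepoint, at_vertex p & x = (\pi_mgspace p)].

Definition edge_interior e : set mgspace :=
  [set x | exists2 s : segment e, 0 < val s < len e & x = pt s].

(* [path_length x y L]: some finite concatenation of segments of edges leads
   from x to y and has total length L. *)
Inductive path_length : mgspace -> mgspace -> R -> Prop :=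
| path_nil x : path_length x x 0
| path_cons e (s t : segment e) y L :
    path_length (pt t) y L -> path_length (pt s) y (`|val s - val t| + L).

Definition mgdist (x y : mgspace) : R := inf [set L | path_length x y L].


Lemma seg_itv e (s : segment e) : 0 <= val s <= len e.
Proof. by have := set_valP s; rewrite /= in_itv. Qed.

Lemma seg0_subproof e : (0 : R) \in [set` `[0, len e]].
Proof. by rewrite inE/= in_itv/= lexx len_ge0. Qed.

Lemma segl_subproof e : len e \in [set` `[0, len e]].
Proof. by rewrite inE/= in_itv/= lexx len_ge0. Qed.

Definition seg0 e : segment e := exist _ 0 (seg0_subproof e).
Definition segl e : segment e := exist _ (len e) (segl_subproof e).

Lemma len_inf_le e : inf (range (@len R V Gr)) <= len e.
Proof.
by apply: ge_inf; [exists 0 => _ [f _ <-]; exact: len_ge0|exists e].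
Qed.

Lemma len_gt0 e : 0 < len e.
Proof. exact: lt_le_trans (len_inf_gt0 Gr) (len_inf_le e). Qed.

Lemma ptP (x : mgspace) : exists e (s : segment e), x = pt s.
Proof.
elim/quotW : x => -[e s].
by exists e, s; rewrite /pt /Tagged.
Qed.

Lemma pi_glue (p q : prepoint) : glue p q ->
  (\pi_mgspace p = \pi_mgspace q).
Proof. by move=> pq; apply/eqmodP. Qed.

Lemma at_vertex0 e : at_vertex (Tagged segment (seg0 e)) = Some (org e).
Proof. by rewrite /at_vertex /position/= eqxx. Qed.

Lemma at_vertexl e : at_vertex (Tagged segment (segl e)) = Some (dst e).
Proof. by rewrite /at_vertex /position/= eqxx gt_eqF// len_gt0. Qed.

Lemma path_length_ge0 x y L : path_length x y L -> 0 <= L.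
Proof. by elim=> // *; rewrite addr_ge0. Qed.

Lemma path_length_cat x y z L M :
  path_length x y L -> path_length y z M -> path_length x z (L + M).
Proof.
elim=> [{}x|e s t {}y {}L _ ih] xz; first by rewrite add0r.
by rewrite -addrA; apply: path_cons; exact: ih.
Qed.

Lemma path_length1 e (s t : segment e) :
  path_length (pt s) (pt t) `|val s - val t|.
Proof. by rewrite -[X in path_length _ _ X]addr0; exact/path_cons/path_nil. Qed.

Lemma path_length_rev x y L : path_length x y L -> path_length y x L.
Proof.
elim=> [{}x|e s t {}y {}L _ ih]; first exact: path_nil.
by rewrite addrC distrC; apply: path_length_cat ih _; exact: path_length1.
Qed.

Definition joined x y := exists L, path_length x y L.

Lemma joined_trans x y z : joined x y -> joined y z -> joined x z.
Proof.
by move=> [L xy] [M yz]; exists (L + M); exact: path_length_cat xy yz.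
Qed.

Lemma joined_sym x y : joined x y -> joined y x.
Proof. by move=> [L xy]; exists L; exact: path_length_rev. Qed.

Lemma joined_seg e (s t : segment e) : joined (pt s) (pt t).
Proof. by exists `|val s - val t|; exact: path_length1. Qed.

Lemma joined_vertices (p q : prepoint) : at_vertex p -> at_vertex q ->
  joined (\pi_mgspace p) (\pi_mgspace q).
Proof.
case vp : (at_vertex p) => [u|//] _; case vq : (at_vertex q) => [v|//] _.
have [w [wp wl]] := graph_connected Gr u v.
elim: w u p vp wp wl => [|u' w ih] u p vp /=.
  move=> _ uv; exists 0.
  rewrite (@pi_glue p q); first exact: path_nil.
  by rewrite /glue vp vq uv eqxx orbT.
case/andP => uu' wp wl.
pose e : edges Gr := exist _ [fset u; u']%fset uu'.
have u_e : u \in [fset org e; dst e]%fset by rewrite -edge_ends/= in_fset2 eqxx.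
have u'_e : u' \in [fset org e; dst e]%fset.
  by rewrite -edge_ends/= in_fset2 eqxx orbT.
have vertex_e x : x \in [fset org e; dst e]%fset ->
    exists s : segment e, at_vertex (Tagged segment s) = Some x.
  rewrite !inE => /orP[/eqP ->|/eqP ->].
    by exists (seg0 e); exact: at_vertex0.
  by exists (segl e); exact: at_vertexl.
have [s us] := vertex_e _ u_e.
have [t u't] := vertex_e _ u'_e.
rewrite (@pi_glue p (Tagged segment s)); last first.
  by rewrite /glue vp us eqxx orbT.
by apply: (joined_trans (joined_seg s t)); exact: ih u't wp wl.
Qed.

Lemma joinedT x y : joined x y.
Proof.
have [e [s ->]] := ptP x; have [f [t ->]] := ptP y.
apply: (joined_trans (joined_seg s (seg0 e))).
apply: (joined_trans _ (joined_seg (seg0 f) t)).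
by apply: joined_vertices; rewrite at_vertex0.
Qed.

Lemma mgdist_le x y L : path_length x y L -> mgdist x y <= L.
Proof.
by move=> xyL; apply: ge_inf => //; exists 0 => M; exact: path_length_ge0.
Qed.

Lemma le_mgdist x y c : (forall L, path_length x y L -> c <= L) ->
  c <= mgdist x y.
Proof. by move=> h; apply: lb_le_inf => //; exact: joinedT. Qed.

Lemma mgdistxx x : mgdist x x = 0.
Proof.
apply/eqP; rewrite eq_le mgdist_le ?le_mgdist//; last exact: path_nil.
by move=> L /path_length_ge0.
Qed.

Lemma mgdist_sym x y : mgdist x y = mgdist y x.
Proof.
by congr inf; apply/seteqP; split => L /=; exact: path_length_rev.
Qed.

Lemma mgdist_triangle y x z : mgdist x z <= mgdist x y + mgdist y z.
Proof.
rewrite -lerBlDr; apply: le_mgdist => L xyL; rewrite lerBlDr -lerBlDl.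
apply: le_mgdist => M yzM; rewrite lerBlDl; apply: mgdist_le.
exact: path_length_cat xyL yzM.
Qed.

Definition glue_compat (f : prepoint -> R) :=
  forall p q, at_vertex p -> at_vertex p = at_vertex q -> f p = f q.

Definition segment_lip (f : prepoint -> R) :=
  forall e (s t : segment e),
    `|f (Tagged segment s) - f (Tagged segment t)| <= `|val s - val t|.

Lemma lip_mgdist (f : prepoint -> R) p q : glue_compat f -> segment_lip f ->
  `|f p - f q| <= mgdist (\pi_mgspace p) (\pi_mgspace q).
Proof.
move=> fc fl.
have fpi r r' : (\pi_mgspace r = \pi_mgspace r') -> f r = f r'.
  move=> /eqmodP; rewrite /= /glue => /orP[/eqP ->//|/andP[vr /eqP]].
  exact: fc.
apply: le_mgdist => L.
set x := (\pi_mgspace p); set y := (\pi_mgspace q).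
move=> xyL; move: {-2}x (erefl x) {-2}y (erefl y) xyL.
move=> x' + y' + xyL.
elim: xyL p @x => [{}x' p x x'p qx'|e s t {}y' {}L _ ih p x sp yq].
  by rewrite (fpi p q) ?subrr ?normr0// -/x -x'p.
rewrite -(fpi (Tagged segment s) p)//.
have := fl _ s t; have := ih (Tagged segment t) erefl yq.
by move=> h1 h2; apply: (le_trans _ (lerD h2 h1)); exact: ler_distD.
Qed.

(* Two functions on the space that are 1-Lipschitz along every edge; they show
   that distinct points are at positive distance. *)
Definition interior_bump e0 (s0 : R) (p : prepoint) : R :=
  let r := Num.min s0 (len e0 - s0) in
  if tag p == e0 then Num.min r `|position p - s0| else r.

Definition vertex_bump (v : V) (p : prepoint) : R :=
  let r := inf (range (@len R V Gr)) in
  Num.min r (Num.min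
    (if org (tag p) == v then position p else r)
    (if dst (tag p) == v then len (tag p) - position p else r)).

Lemma position_itv (p : prepoint) : 0 <= position p <= len (tag p).
Proof. exact: seg_itv. Qed.

Variant at_vertex_spec (p : prepoint) : option V -> Prop :=
| AtOrg of position p = 0 : at_vertex_spec p (Some (org (tag p)))
| AtDst of position p = len (tag p) : at_vertex_spec p (Some (dst (tag p)))
| AtInterior of 0 < position p < len (tag p) : at_vertex_spec p None.

Lemma at_vertexP p : at_vertex_spec p (at_vertex p).
Proof.
rewrite /at_vertex; case: eqP => [|/eqP p0]; first exact: AtOrg.
case: eqP => [|/eqP pl]; first exact: AtDst.
apply: AtInterior; have /andP[h0 hl] := position_itv p.
by rewrite !lt_neqAle h0 hl eq_sym p0 pl.
Qed.

Lemma interior_bump_vertex e0 (s0 : R) p : 0 < s0 < len e0 -> at_vertex p ->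
  interior_bump e0 s0 p = Num.min s0 (len e0 - s0).
Proof.
move=> /andP[h0 hl]; rewrite /interior_bump.
have [pe|//] := eqVneq (tag p) e0.
case: at_vertexP => // pc _; rewrite pc ?pe.
  by rewrite sub0r normrN gtr0_norm//; min_lra.
by rewrite gtr0_norm ?subr_gt0//; min_lra.
Qed.

Lemma interior_bump_compat e0 (s0 : R) : 0 < s0 < len e0 ->
  glue_compat (interior_bump e0 s0).
Proof.
move=> h p q vp vpq; rewrite !interior_bump_vertex//.
by rewrite -vpq.
Qed.

Lemma interior_bump_lip e0 (s0 : R) : segment_lip (interior_bump e0 s0).
Proof.
move=> e s t; rewrite /interior_bump /position/=.
case: ifP => _; last by rewrite subrr normr0.
set r := Num.min s0 _.
have h1 := ler_distD (val t) (val s) s0.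
have h2 := ler_distD (val s) (val t) s0.
rewrite (distrC (val t) (val s)) in h2.
by rewrite ler_norml; apply/andP; split; min_lra.
Qed.

Lemma vertex_bump_vertex v p u : at_vertex p = Some u ->
  vertex_bump v p = if u == v then 0 else inf (range (@len R V Gr)).
Proof.
rewrite /vertex_bump; set r := inf _.
have rl := len_inf_le (tag p); have r0 := len_inf_gt0 Gr.
rewrite -/r in rl r0.
case: at_vertexP => // pc [<-]; rewrite pc;
  do 2 case: ifP => _; min_lra.
Qed.

Lemma vertex_bump_compat v : glue_compat (vertex_bump v).
Proof.
move=> p q; case vp : (at_vertex p) => [u|//] _ vq.
by rewrite (vertex_bump_vertex _ vp) (vertex_bump_vertex _ (esym vq)).
Qed.

Lemma vertex_bump_lip v : segment_lip (vertex_bump v).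
Proof.
move=> e s t; rewrite /vertex_bump /position; set r := inf _.
change (tag (Tagged segment s)) with e; change (tag (Tagged segment t)) with e.
change (tagged (Tagged segment s)) with s; change (tagged (Tagged segment t)) with t.
move: (val s) (val t) => {}s {}t.
have [h1 h2] : s - t <= `|s - t| /\ t - s <= `|s - t|.
  by split; [exact: ler_norm|rewrite distrC; exact: ler_norm].
rewrite ler_norml; move: h1 h2; set n := `|_| => h1 h2.
apply/andP; split; do 2 case: ifP => _;
  min_lra.
Qed.

Lemma mgdist_positivity x y : mgdist x y = 0 -> x = y.
Proof.
elim/quotW : x => p; elim/quotW : y => q pq0.
have r0 := len_inf_gt0 Gr.
have lip0 f : glue_compat f -> segment_lip f -> f p = f q.
  move=> fc fl; have := lip_mgdist p q fc fl.
  by rewrite pq0 normr_le0 subr_eq0 => /eqP.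
case vp : (at_vertex p) => [v|].
  have := lip0 _ (@vertex_bump_compat v) (@vertex_bump_lip v).
  rewrite (vertex_bump_vertex _ vp) eqxx => fq; apply: pi_glue.
  rewrite /glue; apply/orP; right; rewrite vp/=.
  move: fq; rewrite /vertex_bump.
  have rl := len_inf_le (tag q).
  have /andP[q0 ql] := position_itv q.
  rewrite /at_vertex.
  have [qo|qo] := eqVneq (position q) 0.
    rewrite qo; case: ifP => [/eqP ->|_]; first by rewrite eqxx.
    case: ifP => _; min_lra.
  have {}q0 : 0 < position q by rewrite lt_neqAle eq_sym qo.
  have [qd|qd] := eqVneq (position q) (len (tag q)).
    rewrite qd; case: ifP => _; case: ifP => [/eqP ->|_]; rewrite ?eqxx//;
      min_lra.
  have {}ql : position q < len (tag q) by rewrite lt_neqAle qd.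
  do 2 case: ifP => _; min_lra.
have := at_vertexP p; rewrite vp => h; inversion h as [| |hp].
have := lip0 _ (interior_bump_compat hp) (@interior_bump_lip _ _).
rewrite /interior_bump eqxx subrr normr0.
move: hp => /andP[p0 pl].
have m0 : 0 < Num.min (position p) (len (tag p) - position p).
  by rewrite lt_min p0 subr_gt0.
rewrite (min_idPr (ltW m0)).
case: ifP => [/eqP eqp|_]; last by move=> m0'; move: m0; rewrite -m0' ltxx.
move=> /esym pqc.
have {}pqc : position q = position p.
  apply/eqP; rewrite -subr_eq0 -normr_eq0; apply/eqP.
  move: pqc m0; move: (Num.min (position p) _) => m.
  by rewrite minEle; case: ifP => // _ ->; rewrite ltxx.
congr (\pi_mgspace _).
move: p q eqp pqc {pq0 lip0 vp h p0 pl m0} => [e s] [f t] /= fe.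
move: t; rewrite fe => t; rewrite /position/= => st.
by congr existT; exact/esym/val_inj.
Qed.

HB.instance Definition _ := isMetric.Build R mgspace
  mgdistxx mgdist_positivity mgdist_sym mgdist_triangle.

Lemma mdist_mgspaceE (x y : mgspace) : mdist x y = mgdist x y.
Proof. by []. Qed.

Definition mgspace_point : mgspace :=
  pt (seg0 (let: h := cid (graph_degree Gr (graph_base Gr)).2 in
            exist _ (projT1 h) (mem_set (projT2 h).1))).

HB.instance Definition _ := isPointed.Build mgspace mgspace_point.

End metric_graph_space.

Definition dist_open (R : realType) (X : Type) (d : X -> X -> R) : set (set X) :=
  [set U | forall x, U x -> exists2 r, 0 < r & forall y, d x y < r -> U y].

Notation borel d := (g_sigma_algebraType (dist_open d)).

(* The construction is given for a type with a bare "distance" function, so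
   that it can be iterated.  A measure of the library is a function on all
   sets, of which only the values on measurable sets matter: two elements of
   [W2 d] may agree on all Borel sets and still differ as functions.  Such
   elements are at distance 0 from the same points, hence are not separated by
   the Borel sets of [W2dist d]. *)
Section wasserstein_space.
Local Open Scope ereal_scope.
Context (R : realType) (X : pointedType) (d : X -> X -> R).

Record W2 : Type := MkW2 {
  W2_prob :> probability (borel d) R ;
  W2_moment : exists x0, \int[W2_prob]_x ((d x0 x) ^+ 2)%:E < +oo
}.

HB.instance Definition _ := gen_eqMixin W2.
HB.instance Definition _ := gen_choiceMixin W2.

(* For a separable metric d, as is the case on a metric graph, the product
   sigma-algebra is the Borel one of the product. *)
Definition coupling (mu nu : W2) :
    set (probability (borel d * borel d)%type R) :=
  [set pi | (forall A, measurable A -> pushforward pi fst A = mu A) /\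
            (forall A, measurable A -> pushforward pi snd A = nu A)].

Definition transport_cost
    (pi : probability (borel d * borel d)%type R) : \bar R :=
  \int[pi]_z ((d z.1 z.2) ^+ 2)%:E.

(* The minimum of the cost is written as an infimum; it is finite because
   product measures have finite cost. *)
Definition W2dist (mu nu : W2) : R :=
  Num.sqrt (fine (ereal_inf [set transport_cost pi | pi in coupling mu nu])).

End wasserstein_space.

Section dirac_W2.
Local Open Scope ereal_scope.

Import HBNNSimple.

Lemma integral_dirac0 d (T : measurableType d) (R : realType) (a : T)
    (f : T -> \bar R) :
  (forall x, 0 <= f x) -> f a = 0 -> \int[\d_a]_x f x = 0.
Proof.
move=> f0 fa; rewrite ge0_integralTE//.
apply/eqP; rewrite eq_le; apply/andP; split.
  apply: ge_ereal_sup => _ [h hf <-].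
  rewrite -integralT_nnsfun integral_dirac//; last exact/measurable_EFinP.
  by rewrite diracT mul1e -fa; exact: hf.
apply: ereal_sup_ubound; exists nnsfun0 => //; exact: sintegral0.
Qed.

End dirac_W2.

Section barycenter.
Local Open Scope ereal_scope.
Context (R : realType) (X : pmetricType R).

Let dist : X -> X -> R := @mdist R X.

Lemma dirac_W2_moment (x : borel dist) :
  exists x0, \int[\d_x : probability (borel dist) R]_y ((dist x0 y) ^+ 2)%:E < +oo.
Proof.
exists x; rewrite integral_dirac0 ?ltry//.
  by move=> y; rewrite lee_fin sqr_ge0.
by rewrite /dist mdistxx expr0n.
Qed.

HB.instance Definition _ :=
  isPointed.Build (W2 dist) (MkW2 (dirac_W2_moment point)).

Definition WW2 : Type := W2 (@W2dist R X dist).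

Definition barycenter_cost (P : WW2) (mu : W2 dist) : \bar R :=
  \int[P]_nu ((W2dist mu nu) ^+ 2)%:E.

Definition barycenter (P : WW2) : set (W2 dist) :=
  [set mu | forall mu', barycenter_cost P mu <= barycenter_cost P mu'].

End barycenter.

Section hausdorff_measure.
Local Open Scope ereal_scope.
Context (R : realType) (X : metricType R).

Definition diameter (C : set X) : \bar R :=
  ereal_sup (0 |` [set (mdist z.1 z.2)%:E | z in C `*` C]).

(* One-dimensional Hausdorff measure, as an outer measure on all sets. *)
Definition hausdorff1 (A : set X) : \bar R :=
  ereal_sup [set ereal_inf [set \sum_(i <oo) diameter (C i) | C in
      [set C : (set X)^nat | A `<=` \bigcup_i C i /\
                             forall i, diameter (C i) <= delta%:E]]
    | delta in [set delta : R | (0 < delta)%R]].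

Lemma dist_openE : dist_open (@mdist R X) = open.
Proof.
apply/seteqP; split => U /=; rewrite openE.
- move=> oU x Ux; have [r r0 rU] := oU x Ux.
  by apply/nbhs_ballP; exists r => //= y; rewrite ballEmdist; exact: rU.
- move=> oU x /oU /nbhs_ballP[r /= r0 rU]; exists r => // y xyr.
  by apply: rU; rewrite ballEmdist.
Qed.

End hausdorff_measure.

Definition mutually_singular d (T : measurableType d) (R : realType)
    (m1 m2 : set T -> \bar R) :=
  exists N, [/\ measurable N, m2 N = 0%E & m1 (~` N) = 0%E].

(* [ms] is the singular part of [mu] in its Lebesgue decomposition with
   respect to [m]. *)
Definition singular_part d (T : measurableType d) (R : realType)
    (m : set T -> \bar R) (mu ms : {measure set T -> \bar R}) :=
  exists ma : {measure set T -> \bar R},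
    [/\ ma `<< m, mutually_singular ms m &
        forall A, measurable A -> mu A = (ma A + ms A)%E].

Section metric_measure_graph.
Context (R : realType) (V : countType) (Gr : metric_graph R V).

Definition mgW2 : Type := W2 (@mdist R (mgspace Gr)).

Definition mgborel : measurableType _ := borel (@mdist R (mgspace Gr)).

Definition mgH : set mgborel -> \bar R := @hausdorff1 R (mgspace Gr).

Definition W2ac : set mgW2 := [set mu | mu `<< mgH].

Lemma edge_interior_measurable (e : edges Gr) :
  measurable (edge_interior e : set mgborel).
Proof.
apply: sub_sigma_algebra => _ [s s_in ->].
have /andP[s0 sl] := s_in.
exists (Num.min (val s) (len e - val s)).
  by rewrite lt_min s0 subr_gt0.
move=> y; elim/quotW: y => q dq.
set r := Num.min _ _ in dq *.
have r0 : 0 < r by rewrite lt_min s0 subr_gt0.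
have := lip_mgdist (Tagged (@segment _ _ Gr) s) q
  (interior_bump_compat s_in) (@interior_bump_lip _ _ Gr _ _).
move=> /le_lt_trans/(_ dq).
rewrite {1}/interior_bump/= eqxx subrr normr0 -/r (min_idPr (ltW r0)).
rewrite sub0r normrN => /(le_lt_trans (ler_norm _)).
rewrite /interior_bump -/r; case: ifPn => [/eqP qe|]; last by rewrite ltxx.
move: q qe {dq} => [f t] /= fe; move: t; rewrite fe {f fe} => t.
rewrite gt_min ltxx/= => st; exists t => //.
move: st; rewrite /r lt_min !ltr_norml /position/= => /andP[/andP[h1 h2] /andP[h3 h4]].
by move: s0 sl => /= s0 sl; apply/andP; split; lra.
Qed.

End metric_measure_graph.

Arguments mgborel {R V} Gr.
Arguments mgH {R V} Gr.
Arguments W2ac {R V} Gr.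
Arguments vertices {R V} Gr.

(* Main.v *)
(* Suppose that the barycenter mu charges a null subset A of the interior of an
   edge e.  For x in e and y in the graph, a shortest path from x to y can be
   unrolled on the line containing e: it ends at a real number z with
   d(x, y) = |x - z|, and d(x', y) <= |x' - z| for every x' in e.  Cover A,
   up to a small part of its mass, by finitely many disjoint sets J_k, of mass
   m_k and of diameters with a small sum.  The competitor replaces mu on J_k by
   the law obtained from two independent points of J_k by moving the larger one
   up and the smaller one down by t / m_k.  From any coupling of mu and nu one
   gets a coupling of the competitor and nu: draw two independent pairs (x, y)
   with x in J_k, and give the larger x to the larger z and the smaller x to
   the smaller z.  Sorting does not increase the cost, and the shift
   decreases it, to first order in t, by t times the sum over k of the mean of
   |z - z'| minus t times the sum of the diameters.  If nu is absolutely
   continuous, the values z cannot concentrate on a set of small length, which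
   bounds the sum of the mean deviations from below, uniformly on a set of
   measures nu of positive P-measure.  Hence the competitor has a smaller cost
   when t and the diameters are small.  No optimal coupling, disintegration or
   measurable selection is needed. *)
From HB Require Import structures.
Require Import Defs.
From mathcomp Require Import all_boot all_order all_algebra finmap.
From mathcomp Require Import generic_quotient.
From mathcomp Require Import all_classical all_reals all_analysis.
From mathcomp Require Import ring lra measurable_realfun.

Set Implicit Arguments.
Unset Strict Implicit.
Unset Printing Implicit Defensive.

Import Order.TTheory GRing.Theory Num.Theory.
Import numFieldNormedType.Exports.

Local Open Scope classical_set_scope.
Local Open Scope ring_scope.
Local Open Scope ereal_scope.

(** * Ball covers *)

Section ball_covers.
Context (R : realType) (X : pseudoMetricType R).
Implicit Types (S : set X) (eta : R).

Definition ball_cover (c : X^nat) (r : R^nat) : set X :=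
  \bigcup_i ball (c i) (r i).

Definition ball_covered eta S := exists c : X^nat, exists r : R^nat,
  [/\ forall i, (0 <= r i)%R, \sum_(i <oo) (r i)%:E <= eta%:E &
      S `<=` ball_cover c r].

(** Negligibility for one-dimensional Hausdorff measure, expressed with open balls so that every
    cover is an open set. A ball of radius 0 is empty, which lets finite covers be padded to
    sequences. *)
Definition ball_null S := forall eta : R, (0 < eta)%R -> ball_covered eta S.

Lemma sub_ball_covered eta S S' : S `<=` S' -> ball_covered eta S' -> ball_covered eta S.
Proof.
by move=> SS' [c [r [r0 rS h]]]; exists c, r; split => //; exact: subset_trans h.
Qed.

Lemma le_ball_covered eta eta' S : (eta <= eta')%R -> ball_covered eta S -> ball_covered eta' S.
Proof.
by move=> ee' [c [r [r0 rS h]]]; exists c, r; split => //;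
   rewrite (le_trans rS)// lee_fin.
Qed.

(** A bijection of [nat] with pairs enumerates the balls of all covers, and the double series of
    nonnegative radii is reordered as an [esum]. *)
Lemma ball_covered_bigcup (S : (set X)^nat) (eta : R^nat) (e : R) :
  (forall j, ball_covered (eta j) (S j)) -> \sum_(j <oo) (eta j)%:E <= e%:E ->
  ball_covered e (\bigcup_j S j).
Proof.
move=> /choice[c /choice[r h]] he.
have /card_esym/ppcard_eqP[f] := card_nat2.
exists (fun n => c (f n).1 (f n).2), (fun n => r (f n).1 (f n).2); split.
- by move=> n; have [] := h (f n).1.
- apply: le_trans he.
  have r0 i j : 0 <= (r i j)%:E by rewrite lee_fin; have [] := h i.
  have rn i : 0 <= \sum_(j <oo) (r i j)%:E by apply: nneseries_ge0.
  apply: (@le_trans _ _ (\sum_(i <oo) \sum_(j <oo) (r i j)%:E)); last first.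
    by apply: lee_nneseries => // i _; have [] := h i.
  rewrite !nneseries_esumT//.
  under [leRHS]eq_esum do rewrite nneseries_esumT//.
  rewrite esum_esum//.
  have XT : [set: nat] `*`` (fun=> [set: nat]) = setT by apply/seteqP; split.
  by rewrite XT (reindex_esum setT _ f)//; exact: bijTT.
- move=> x [j _ Sjx]; have [_ _ /(_ _ Sjx)[i _ xi]] := h j.
  have [n _ fn] := @surj _ _ _ _ f (j, i) I.
  by exists n => //; rewrite fn.
Qed.

Lemma sum_halves (e : R) : (0 <= e)%R ->
  \sum_(i <oo) (e / (2 ^ i.+1)%:R)%:E <= e%:E.
Proof. by move=> e0; rewrite (le_trans (epsilon_trick0 xpredT e0)). Qed.

Lemma sum_halves_tail (e : R) n : (0 <= e)%R ->
  \sum_(i <oo) (e / (2 ^ (n + i).+1)%:R)%:E <= (e / (2 ^ n)%:R)%:E.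
Proof.
move=> e0; apply: le_trans (@sum_halves (e / (2 ^ n)%:R) _).
  apply: lee_nneseries => [i _|i _].
    by rewrite lee_fin divr_ge0.
  by rewrite lee_fin -addnS expnD natrM invfM mulrA.
by rewrite divr_ge0.
Qed.

Lemma ball_null_bigcup (S : (set X)^nat) : (forall j, ball_null (S j)) ->
  ball_null (\bigcup_j S j).
Proof.
move=> h e e0; apply: (@ball_covered_bigcup _ (fun j => e / (2 ^ j.+1)%:R)%R).
  by move=> j; apply: h; rewrite divr_gt0// ltr0n expn_gt0.
by apply: sum_halves; exact: ltW.
Qed.

Lemma sub_ball_null S S' : S `<=` S' -> ball_null S' -> ball_null S.
Proof. by move=> SS' h e e0; apply: sub_ball_covered SS' _; exact: h. Qed.

End ball_covers.

(** * Uniform smallness of the preimages of small covers *)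

Section borel_cantelli.
Context d (T : measurableType d) (R : realType).

(* Borel-Cantelli: otherwise the upper limit of the preimages of covers of size
   [2 ^- n] would be the preimage of a null set and have positive measure. *)
Lemma null_preimage_modulus (Y : pseudoMetricType R) (f : T -> Y)
    (m : {measure set T -> \bar R}) (eps : R) :
  m setT < +oo ->
  (forall c r, measurable (f @^-1` (ball c r))) ->
  (forall N : set Y, measurable (f @^-1` N) -> ball_null N -> m (f @^-1` N) = 0) ->
  (0 < eps)%R ->
  exists n : nat, forall (c : Y^nat) (r : R^nat), (forall i, (0 <= r i)%R) ->
    \sum_(i <oo) (r i)%:E <= ((n.+1)%:R^-1)%:E ->
    m (f @^-1` (ball_cover c r)) <= eps%:E.
Proof.
move=> mT mf null eps0; apply: contrapT => /forallNP H.
have {}H n : exists cr : Y^nat * R^nat, [/\ forall i, (0 <= cr.2 i)%R,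
    \sum_(i <oo) (cr.2 i)%:E <= ((2 ^ n.+1)%:R^-1)%:E &
    eps%:E < m (f @^-1` (ball_cover cr.1 cr.2))].
  (* The index 2^(n+1) makes the sizes of the covers summable; its bound 1 / (2^(n+1) + 1) is below
     2^-(n+1). *)
  have /existsNP[c /existsNP[r]] := H (2 ^ n.+1)%N.
  move=> /not_implyP[r0 /not_implyP[rs /negP]]; rewrite -ltNge => h.
  exists (c, r); split => //; apply: le_trans rs _.
  by rewrite lee_fin lef_pV2 ?posrE ?ltr0n ?expn_gt0// ler_nat.
have {H}[cr H] := choice H.
pose F n := f @^-1` (ball_cover (cr n).1 (cr n).2).
have mF n : measurable (F n).
  rewrite /F /ball_cover preimage_bigcup; apply: bigcup_measurable => i _.
  exact: mf.
pose N := lim_sup_set (fun n => ball_cover (cr n).1 (cr n).2).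
have fN : f @^-1` N = lim_sup_set F.
  by rewrite /N /lim_sup_set preimage_bigcap; apply: eq_bigcapr => i _;
    rewrite preimage_bigcup.
have cN : ball_null N.
  move=> e e0.
  have [n ne] : exists n, ((2 ^ n)%:R^-1 <= e :> R)%R.
    have [n _ ne] : \forall n \near \oo, (1 / 2 ^+ n < e :> R)%R.
      exact: @near_infty_natSinv_expn_lt R (PosNum e0).
    by exists n; rewrite natrX ltW// -div1r; apply: ne => /=.
  apply: (le_ball_covered ne).
  (* The upper limit lies in each tail union, and the covers from index [n] on have total size at
     most 2^-n. *)
  apply: (@sub_ball_covered _ _ _ _ (\bigcup_i
      (ball_cover (cr (n + i)%N).1 (cr (n + i)%N).2))).
    move=> x /(_ n I)[k /= nk xk]; exists (k - n)%N => //.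
    by rewrite subnKC.
  apply: (@ball_covered_bigcup _ _ _ (fun i => ((2 ^ (n + i).+1)%:R^-1)%R)).
    by move=> i; exists (cr (n + i)%N).1, (cr (n + i)%N).2; split => //;
      have [] := H (n + i)%N.
  have := @sum_halves_tail R 1 n ler01; rewrite div1r.
  by under eq_eseriesr do rewrite div1r.
have mN : measurable (f @^-1` N).
  rewrite fN; apply: bigcap_measurable => // i _.
  by apply: bigcup_measurable => j _; exact: mF.
have := null N mN cN; rewrite fN => N0.
(* Continuity from above, which the finiteness of [m] allows: each tail union contains some [F n],
   of measure above [eps]. *)
have : eps%:E <= m (lim_sup_set F).
  have cvgF := lim_sup_set_cvg m F mF.
  have /cvgF{}cvgF : m (\bigcup_(k in [set k | (0 <= k)%N]) F k) < +oo.
    apply: le_lt_trans mT; apply: le_measure; rewrite ?inE//.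
    by apply: bigcup_measurable => j _; exact: mF.
  rewrite -(cvg_lim _ cvgF)//; apply: lime_ge; first by apply/cvg_ex; eexists; exact: cvgF.
  apply: nearW => n; have [_ _ /ltW h] := H n.
  apply: le_trans h _; apply: le_measure; rewrite ?inE.
  - exact: mF.
  - by apply: bigcup_measurable => j _; exact: mF.
  - by move=> x Fx; exists n => /=.
by rewrite N0 lee_fin leNgt eps0.
Qed.

End borel_cantelli.

(** * Null sets of the Hausdorff measure as ball-null sets *)

Section hausdorff_null.
Context (R : realType) (X : pmetricType R).

Lemma diameter_ge0 (C : set X) : 0 <= diameter C.
Proof. by apply: ereal_sup_ubound; left. Qed.

Lemma diameter_ge (C : set X) x y : C x -> C y -> (mdist x y)%:E <= diameter C.
Proof. by move=> Cx Cy; apply: ereal_sup_ubound; right; exists (x, y). Qed.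

Lemma diameter_ball (c : X) r : (0 <= r)%R -> diameter (ball c r) <= (r + r)%:E.
Proof.
move=> r0; apply: ge_ereal_sup => _ [->|[[x y] [/= cx cy] <-]].
  by rewrite lee_fin addr_ge0.
rewrite lee_fin (le_trans (metric_triangle _ c _))//.
rewrite !ballEmdist /= in cx cy; rewrite metric_sym.
by rewrite lerD// ltW.
Qed.

Lemma hausdorff1_ge0 (A : set X) : 0 <= hausdorff1 A.
Proof.
apply: le_ereal_sup_tmp; eexists; first by exists 1%R; [exact: ltr01|reflexivity].
by apply: le_ereal_inf_tmp => _ [C _ <-]; apply: nneseries_ge0 => i _ _;
  exact: diameter_ge0.
Qed.

Lemma ball_null_hausdorff1 (A : set X) : ball_null A -> hausdorff1 A = 0.
Proof.
move=> A0; apply/eqP; rewrite eq_le hausdorff1_ge0 andbT.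
apply: ge_ereal_sup => _ [/= del del0 <-].
apply/lee_addgt0Pr => e e0; rewrite add0e.
(* Half of this minimum bounds the radii: diameters are at most twice the radii, [del] bounds each
   of them and [e] their sum. *)
have m0 : (0 < Num.min del e)%R by rewrite lt_min del0 e0.
have [c [r [r0 rs AC]]] := A0 _ (divr_gt0 m0 (ltr0n _ 2)).
have rs2 : \sum_(i <oo) (r i + r i)%:E <= (Num.min del e)%:E.
  under eq_eseriesr do rewrite EFinD.
  rewrite nneseriesD; [|by move=> ? _; rewrite lee_fin..].
  by rewrite [leRHS](_ : _ = (Num.min del e / 2)%:E + (Num.min del e / 2)%:E) ?leeD//
     -EFinD -splitr.
have rr0 i : 0 <= (r i + r i)%:E by rewrite lee_fin addr_ge0.
apply: (@le_trans _ _ (\sum_(i <oo) diameter (ball (c i) (r i)))).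
  apply: ereal_inf_lbound; exists (fun i => ball (c i) (r i)) => //; split => // i.
  rewrite (le_trans (diameter_ball _ (r0 i)))//.
  apply: (@le_trans _ _ (Num.min del e)%:E); last by rewrite lee_fin ge_min lexx.
  apply: le_trans rs2.
  rewrite (@nneseriesD1 _ (fun i => (r i + r i)%:E) i) //.
  by rewrite leeDl// nneseries_ge0.
apply: (@le_trans _ _ (\sum_(i <oo) (r i + r i)%:E)).
  apply: lee_nneseries => i _; first by move=> _; exact: diameter_ge0.
  exact: diameter_ball.
by rewrite (le_trans rs2)// lee_fin ge_min lexx orbT.
Qed.

(** A set lies in the ball around any of its points whose radius is its diameter plus a positive
    slack, as balls are open; the slacks sum to at most [e / 2]. An empty set gets an arbitrary
    center. *)
Lemma hausdorff1_ball_null (A : set X) : hausdorff1 A = 0 -> ball_null A.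
Proof.
move=> A0 e e0.
have e20 : (0 < e / 2)%R by rewrite divr_gt0.
have : ereal_inf [set \sum_(i <oo) diameter (C i) | C in
      [set C : (set X)^nat | A `<=` \bigcup_i C i /\
                             forall i, diameter (C i) <= 1%:E]] < (e / 2)%:E.
  rewrite (@le_lt_trans _ _ 0)// ?lte_fin// -[leRHS]A0.
  by apply: ereal_sup_ubound; exists 1%R => //=.
move=> /ereal_inf_lt[_ [C [AC C1] <-] Ce].
have dfin i : diameter (C i) \is a fin_num.
  by rewrite ge0_fin_numE ?diameter_ge0// (le_lt_trans (C1 i))// ltry.
pose c i : X := xget point (C i).
pose r i := (fine (diameter (C i)) + (e / 2) / (2 ^ i.+1)%:R)%R.
have p0 i : (0 < (e / 2) / (2 ^ i.+1)%:R)%R by rewrite divr_gt0// ltr0n expn_gt0.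
exists c, r; split.
- by move=> i; rewrite addr_ge0 ?fine_ge0 ?diameter_ge0// ltW.
- rewrite /r; under eq_eseriesr do rewrite EFinD fineK//.
  rewrite nneseriesD; [|by move=> *; exact: diameter_ge0|by move=> *; rewrite lee_fin ltW].
  rewrite [e in leRHS](splitr e) EFinD leeD//; first exact: ltW.
  by apply: sum_halves; exact: ltW.
- move=> x /AC[i _ Cix]; exists i => //.
  rewrite ballEmdist /=.
  rewrite (@le_lt_trans _ _ (fine (diameter (C i))))// ?ltrDl//.
  rewrite -lee_fin fineK//; apply: diameter_ge => //.
  by apply: xgetI Cix.
Qed.

(** In [<<] a null set is one whose measurable subsets all have measure 0; ball-nullity passes to
    subsets, so testing measurable sets suffices. *)
Lemma null_dominates_hausdorff1P (m : {measure set (borel (@mdist R X)) -> \bar R}) :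
  m `<< (@hausdorff1 R X : set (borel (@mdist R X)) -> \bar R) <->
  forall A : set (borel (@mdist R X)), measurable A -> @ball_null R X A -> m A = 0.
Proof.
split => [mH A mA A0|h N HN A mA AN].
  apply: (mH A) => // B mB BA; apply: ball_null_hausdorff1.
  exact: sub_ball_null BA A0.
by apply: h => //; apply: hausdorff1_ball_null; exact: HN.
Qed.

End hausdorff_null.

(** * Couplings in the Wasserstein space *)

Section measure_tools.
Context d (T : measurableType d) (R : realType).

Section mkprob.
Variables (m : {measure set T -> \bar R}) (m1 : m setT = 1).

Definition mkprob_fun : set T -> \bar R := m.
HB.instance Definition _ := Measure.on mkprob_fun.
HB.instance Definition _ := Measure_isProbability.Build _ _ _ mkprob_fun m1.
Definition mkprob : probability T R := mkprob_fun.

End mkprob.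

Lemma markov_ge0 (m : {measure set T -> \bar R}) (f : T -> R) (D : set T) (c : R) :
  measurable D -> measurable_fun setT f -> (forall x, (0 <= f x)%R) -> (0 <= c)%R ->
  c%:E * m (D `&` [set x | (c <= f x)%R]) <= \int[m]_(x in D) (f x)%:E.
Proof.
move=> mD mf f0 c0.
have mS : measurable (D `&` [set x | (c <= f x)%R]).
  apply: measurableI => //; rewrite -[X in measurable X]setTI.
  by rewrite -preimage_itvcy; exact: mf.
rewrite -integral_cst//.
apply: (@le_trans _ _ (\int[m]_(x in D `&` [set x | (c <= f x)%R]) (f x)%:E)).
  apply: ge0_le_integral => //; last by move=> x [_ /=]; rewrite lee_fin.
  by apply/measurable_EFinP; exact: measurable_funTS.
apply: ge0_subset_integral => //; first by apply/measurable_EFinP; exact: measurable_funTS.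
by move=> x _; rewrite lee_fin.
Qed.

Lemma ge0_integral_mrestr (m : {measure set T -> \bar R}) (D : set T)
    (mD : measurable D) (f : T -> \bar R) :
  measurable_fun setT f -> (forall x, 0 <= f x) ->
  \int[mrestr m mD]_x f x = \int[m]_(x in D) f x.
Proof.
move=> mf f0; rewrite (@ge0_negligible_integral _ _ _ (mrestr m mD) setT (~` D))//; first last.
- by change (m (~` D `&` D) = 0); rewrite setICl measure0.
- exact: measurableC.
rewrite setDE setTI setCK; apply: eq_measure_integral => A mA AD.
by change (m (A `&` D) = m A); rewrite setIidl.
Qed.

(* Holds without measurability: the integral is a supremum over the simple
   functions below. *)
Lemma le_lower_integral (m : {measure set T -> \bar R}) (f g : T -> \bar R) :
  (forall x, 0 <= f x) -> (forall x, f x <= g x) ->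
  \int[m]_x f x <= \int[m]_x g x.
Proof.
move=> f0 fg; rewrite !ge0_integralTE//; last by move=> x; rewrite (le_trans (f0 x)).
apply: ereal_sup_le => _ [h hf <-]; exists h => // x; exact: le_trans (fg x).
Qed.

Import HBNNSimple.

(** [f] may be non-measurable: each simple function below [f] is added to the measurable [g], whose
    finite integral can be subtracted. *)
Lemma ge0_le_lower_integralD (m : {measure set T -> \bar R}) (f g : T -> \bar R) :
  (forall x, 0 <= f x) -> (forall x, 0 <= g x) -> measurable_fun setT g ->
  \int[m]_x g x < +oo ->
  \int[m]_x f x + \int[m]_x g x <= \int[m]_x (f x + g x).
Proof.
move=> f0 g0 mg goo.
have gfin : \int[m]_x g x \is a fin_num by rewrite ge0_fin_numE// integral_ge0.
rewrite -leeBrDr// [X in X <= _]ge0_integralTE//.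
apply: ge_ereal_sup => _ [h hf <-]; rewrite leeBrDr//.
rewrite -integralT_nnsfun -ge0_integralD//; last 2 first.
- by move=> x _; rewrite lee_fin.
- exact/measurable_EFinP.
apply: le_lower_integral => [x|x]; first by rewrite adde_ge0// lee_fin.
by rewrite leeD2r// hf.
Qed.

Lemma prob_integral_cst (m : probability T R) (c : R) : \int[m]_x c%:E = c%:E.
Proof.
by rewrite (integral_cst m measurableT) -[RHS]mule1; congr (_ * _);
  exact: probability_setT.
Qed.

(** For a possibly non-measurable [f]: if a simple [h] is below f + c, then the positive part of h -
    c is measurable and below [f]. *)
Lemma lower_integral_le_cst (m : probability T R) (f : T -> \bar R) (c : R) :
  (forall x, 0 <= f x) -> (0 <= c)%R ->
  \int[m]_x (f x + c%:E) <= \int[m]_x f x + c%:E.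
Proof.
move=> f0 c0; rewrite ge0_integralTE; last by move=> x; rewrite adde_ge0// lee_fin.
apply: ge_ereal_sup => _ [h hf <-]; rewrite -integralT_nnsfun.
pose g x := (Num.max (h x - c) 0)%R.
have mg : measurable_fun setT g.
  by apply: measurable_maxr => //; apply: measurable_funB.
apply: (@le_trans _ _ (\int[m]_x ((g x)%:E + c%:E))).
  apply: ge0_le_integral => //.
  - by move=> x _; rewrite lee_fin.
  - exact/measurable_EFinP.
  - by apply: emeasurable_funD => //; exact/measurable_EFinP.
  - by move=> x _; rewrite -EFinD lee_fin -lerBlDr le_max lexx.
rewrite ge0_integralD//; last 2 first.
- by move=> x _; rewrite lee_fin le_max lexx orbT.
- exact/measurable_EFinP.
rewrite prob_integral_cst leeD2r//; apply: le_lower_integral => x; first by rewrite lee_fin le_max lexx orbT.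
rewrite /g EFin_max ge_max f0 andbT EFinB leeBlDr//.
Qed.

End measure_tools.

(** * Borel measurability in a metric space *)

Section metric_borel.
Context (R : realType) (X : pmetricType R).
Local Notation BX := (borel (@mdist R X)).

Lemma ball_dist_open (x : X) r : dist_open (@mdist R X) (ball x r).
Proof.
move=> y; rewrite ballEmdist /= => xy; exists (r - mdist x y)%R.
  by rewrite subr_gt0.
move=> z; rewrite ltrBrDl; apply: le_lt_trans.
exact: metric_triangle.
Qed.

Lemma borel_dist_open (U : set X) : dist_open (@mdist R X) U ->
  measurable (U : set BX).
Proof. by move=> oU; apply: sub_sigma_algebra. Qed.

Lemma borel_ball (x : X) r : measurable (ball x r : set BX).
Proof. by apply: borel_dist_open; exact: ball_dist_open. Qed.

Definition lip1 (f : X -> R) := forall x y, (f y <= f x + mdist x y)%R.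

Lemma lip1_dist_open (f : X -> R) (O : set R) : lip1 f -> open O ->
  dist_open (@mdist R X) (f @^-1` O).
Proof.
move=> lf + x Ofx; rewrite openE => /(_ _ Ofx) /nbhs_ballP[r /= r0 rO].
exists r => // y xyr; apply: rO; rewrite /ball/=.
apply: le_lt_trans xyr; rewrite ler_norml.
have h1 := lf x y; have := lf y x; rewrite (metric_sym y) => h2.
by apply/andP; split; lra.
Qed.

Lemma lip1_measurable (f : X -> R) : lip1 f -> measurable_fun setT (f : BX -> R).
Proof.
move=> lf; apply: (measurability _ (RGenOInfty.measurableE R)) => //.
move=> /= _ [_ [a ->] <-]; rewrite setTI; apply: borel_dist_open.
by apply: lip1_dist_open => //; exact: interval_open.
Qed.

Lemma mdist_lip1 (x : X) : lip1 (mdist x).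
Proof. by move=> y z; exact: metric_triangle. Qed.

Lemma measurable_mdistr (x : X) : measurable_fun setT (mdist x : BX -> R).
Proof. by apply: (lip1_measurable (@mdist_lip1 x)). Qed.

Lemma contraction_measurable (g : R -> X) :
  (forall s t, mdist (g s) (g t) <= `|s - t|)%R ->
  measurable_fun setT (g : R -> BX).
Proof.
move=> lg; apply: (@measurability _ _ (measurableTypeR R) BX setT g (dist_open (@mdist R X))) => //.
move=> _ [U oU <-]; rewrite setTI; apply: open_measurable.
rewrite openE => s /oU[r r0 rU]; apply/nbhs_ballP; exists r => //= t st.
by apply: rU; apply: le_lt_trans (lg _ _) _.
Qed.

Definition dense_seq (D : X^nat) :=
  forall (x : X) (r : R), (0 < r)%R -> exists n, (mdist (D n) x < r)%R.

(* Joint measurability for the product sigma-algebra requires separability. *)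
Lemma measurable_mdist (D : X^nat) : dense_seq D ->
  measurable_fun setT (fun z : BX * BX => mdist z.1 z.2).
Proof.
move=> Dd; apply: (measurability _ (RGenInftyO.measurableE R)) => //.
move=> /= _ [_ [a ->] <-]; rewrite setTI.
(* By density, d(x, y) < a iff some [D n] satisfies d(D n, x) + d(D n, y) < a; each summand depends
   on one variable. *)
rewrite [X in measurable X](_ : _ = \bigcup_n
    ((fun z : BX * BX => mdist (D n) z.1 + mdist (D n) z.2)%R @^-1` `]-oo, a[)).
  apply: bigcupT_measurable => n; rewrite -[X in measurable X]setTI.
  suff : measurable_fun setT
      (fun z : BX * BX => mdist (D n) z.1 + mdist (D n) z.2)%R.
    by apply=> //; exact: measurable_itv.
  apply: measurable_funD.
    exact: (measurableT_comp (measurable_mdistr _) measurable_fst).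
  exact: (measurableT_comp (measurable_mdistr _) measurable_snd).
apply/seteqP; split => [[x y]|[x y] [n _]] /=; rewrite !in_itv/=.
  move=> xya; have [n nx] := Dd x ((a - mdist x y) / 2)%R ltac:(by rewrite divr_gt0// subr_gt0).
  exists n => //=; rewrite in_itv/=.
  have := @metric_triangle _ X (D n) x y; rewrite ltr_pdivlMr// in nx; lra.
move=> h; apply: le_lt_trans h; rewrite (@metric_sym _ X (D n) x).
exact: (@metric_triangle _ X).
Qed.

End metric_borel.

(** * Finiteness of the Wasserstein distance and comparison of moments *)

Section wasserstein.
Context (R : realType) (X : pmetricType R).
Local Notation d := (@mdist R X).
Local Notation BX := (borel d).
Context (D : X^nat) (Dd : dense_seq D).

Lemma measurable_sqr_mdistr (x : X) :
  measurable_fun setT (fun y : BX => ((d x y) ^+ 2)%:E).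
Proof. by apply/measurable_EFinP/measurable_funX; exact: measurable_mdistr. Qed.

Lemma measurable_sqr_mdist :
  measurable_fun setT (fun z : BX * BX => ((d z.1 z.2) ^+ 2)%:E).
Proof. by apply/measurable_EFinP/measurable_funX; exact: measurable_mdist Dd. Qed.

Section fixed_coupling.
Context (mu nu : W2 d) (pi : probability (BX * BX)%type R).
Hypothesis cpi : coupling mu nu pi.

Lemma coupling_integral_fst (f : BX -> \bar R) : measurable_fun setT f ->
  (forall x, 0 <= f x) -> \int[pi]_z f z.1 = \int[mu]_x f x.
Proof.
move=> mf f0.
rewrite -(@ge0_integral_pushforward _ _ _ _ _ _ measurable_fst pi setT f)//.
by apply: eq_measure_integral => A mA _; exact: cpi.1.
Qed.

Lemma coupling_integral_snd (f : BX -> \bar R) : measurable_fun setT f ->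
  (forall x, 0 <= f x) -> \int[pi]_z f z.2 = \int[nu]_x f x.
Proof.
move=> mf f0.
rewrite -(@ge0_integral_pushforward _ _ _ _ _ _ measurable_snd pi setT f)//.
by apply: eq_measure_integral => A mA _; exact: cpi.2.
Qed.

Lemma sqrrD_le2 (a b c : R) : (0 <= a)%R -> (a <= b + c)%R ->
  (a ^+ 2 <= 2 * b ^+ 2 + 2 * c ^+ 2)%R.
Proof. by move=> a0 abc; have := sqr_ge0 (b - c)%R; nra. Qed.

Lemma transport_cost_le (x0 : X) :
  transport_cost pi <=
    2%:E * (\int[mu]_x ((d x0 x) ^+ 2)%:E + \int[nu]_x ((d x0 x) ^+ 2)%:E).
Proof.
rewrite -coupling_integral_fst; [|exact: measurable_sqr_mdistr|by move=> *; rewrite lee_fin sqr_ge0].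
rewrite -coupling_integral_snd; [|exact: measurable_sqr_mdistr|by move=> *; rewrite lee_fin sqr_ge0].
have m1 : measurable_fun setT (fun z : BX * BX => ((d x0 z.1) ^+ 2)%:E).
  exact: (measurableT_comp (measurable_sqr_mdistr _) measurable_fst).
have m2 : measurable_fun setT (fun z : BX * BX => ((d x0 z.2) ^+ 2)%:E).
  exact: (measurableT_comp (measurable_sqr_mdistr _) measurable_snd).
have p1 (z : BX * BX) : 0 <= ((d x0 z.1) ^+ 2)%:E by rewrite lee_fin sqr_ge0.
have p2 (z : BX * BX) : 0 <= ((d x0 z.2) ^+ 2)%:E by rewrite lee_fin sqr_ge0.
rewrite -ge0_integralD// -ge0_integralZl//; last 2 first.
- exact: emeasurable_funD.
- by move=> z _; rewrite adde_ge0.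
apply: ge0_le_integral => //.
- by move=> z _; rewrite lee_fin sqr_ge0.
- exact: measurable_sqr_mdist.
- by apply: measurable_funeM; exact: emeasurable_funD.
- move=> z _; rewrite -EFinD -EFinM lee_fin mulrDr; apply: sqrrD_le2.
    exact: mdist_ge0.
  by rewrite (@metric_sym _ X x0 z.1) metric_triangle.
Qed.

Lemma moment_le_transport_cost (x0 : X) :
  \int[nu]_x ((d x0 x) ^+ 2)%:E <=
    2%:E * (\int[mu]_x ((d x0 x) ^+ 2)%:E + transport_cost pi).
Proof.
rewrite -coupling_integral_fst; [|exact: measurable_sqr_mdistr|by move=> *; rewrite lee_fin sqr_ge0].
rewrite -coupling_integral_snd; [|exact: measurable_sqr_mdistr|by move=> *; rewrite lee_fin sqr_ge0].
have m1 : measurable_fun setT (fun z : BX * BX => ((d x0 z.1) ^+ 2)%:E).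
  exact: (measurableT_comp (measurable_sqr_mdistr _) measurable_fst).
have m2 : measurable_fun setT (fun z : BX * BX => ((d x0 z.2) ^+ 2)%:E).
  exact: (measurableT_comp (measurable_sqr_mdistr _) measurable_snd).
have m3 := measurable_sqr_mdist.
have p1 (z : BX * BX) : 0 <= ((d x0 z.1) ^+ 2)%:E by rewrite lee_fin sqr_ge0.
have p2 (z : BX * BX) : 0 <= ((d z.1 z.2) ^+ 2)%:E by rewrite lee_fin sqr_ge0.
rewrite -ge0_integralD// -ge0_integralZl//; last 2 first.
- exact: emeasurable_funD.
- by move=> z _; rewrite adde_ge0.
apply: ge0_le_integral => //.
- by move=> z _; rewrite lee_fin sqr_ge0.
- by apply: measurable_funeM; exact: emeasurable_funD.
- move=> z _; rewrite -EFinD -EFinM lee_fin mulrDr; apply: sqrrD_le2.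
    exact: mdist_ge0.
  exact: metric_triangle.
Qed.

End fixed_coupling.

(** Passes from some base point, as in the definition of [W2], to every base point. *)
Lemma W2_moment_lty (mu : W2 d) (x0 : X) :
  \int[mu]_x ((d x0 x) ^+ 2)%:E < +oo.
Proof.
have [x1 h] := W2_moment mu.
apply: (@le_lt_trans _ _
    (\int[mu]_x ((2 * (d x0 x1) ^+ 2)%:E + 2%:E * ((d x1 x) ^+ 2)%:E))).
  apply: le_lower_integral => x; first by rewrite lee_fin sqr_ge0.
  rewrite -EFinM -EFinD lee_fin; apply: sqrrD_le2; first exact: mdist_ge0.
  exact: metric_triangle.
have m1 := measurable_sqr_mdistr x1.
rewrite ge0_integralD//; last 3 first.
- by move=> x _; rewrite lee_fin mulr_ge0// sqr_ge0.
- by move=> x _; rewrite -EFinM lee_fin mulr_ge0// sqr_ge0.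
- exact: measurable_funeM.
rewrite ge0_integralZl//; last by move=> x _; rewrite lee_fin sqr_ge0.
rewrite prob_integral_cst lte_add_pinfty ?ltry//.
by rewrite lte_mul_pinfty// lee_fin.
Qed.

Lemma coupling_nonempty (mu nu : W2 d) : coupling mu nu !=set0.
Proof.
have h A B : measurable A -> measurable B ->
    (W2_prob mu \x W2_prob nu) (A `*` B) = mu A * nu B.
  by move=> mA mB; rewrite [LHS]product_measure1E.
have p1 : (W2_prob mu \x W2_prob nu) setT = 1.
  rewrite -setXTT h//; rewrite -[RHS]mule1; congr (_ * _); exact: probability_setT.
exists (mkprob p1); split => A mA.
- rewrite /pushforward -[fst @^-1` A](_ : A `*` setT = _).
    rewrite [LHS]h// -[RHS]mule1; congr (_ * _); exact: probability_setT.
  by apply/seteqP; split => [[x y] []//|[x y] /= ?]; split.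
- rewrite /pushforward -[snd @^-1` A](_ : setT `*` A = _).
    rewrite [LHS]h// -[RHS]mul1e; congr (_ * _); exact: probability_setT.
  by apply/seteqP; split => [[x y] []//|[x y] /= ?]; split.
Qed.

(** The product coupling has finite cost, so [fine] loses nothing. Bounds on distances are then
    proved coupling by coupling. *)
Lemma W2dist_sqE (mu nu : W2 d) :
  ((W2dist mu nu) ^+ 2)%:E =
    ereal_inf [set transport_cost pi | pi in coupling mu nu].
Proof.
have i0 : 0 <= ereal_inf [set transport_cost pi | pi in coupling mu nu].
  by apply: le_ereal_inf_tmp => _ [pi _ <-]; apply: integral_ge0 => z _;
     rewrite lee_fin sqr_ge0.
rewrite /W2dist sqr_sqrtr ?fine_ge0// fineK// ge0_fin_numE//.
have [pi cpi] := coupling_nonempty mu nu.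
apply: (@le_lt_trans _ _ (transport_cost pi)).
  by apply: ereal_inf_lbound; exists pi.
apply: (le_lt_trans (transport_cost_le cpi point)).
rewrite lte_mul_pinfty// lte_add_pinfty//; exact: W2_moment_lty.
Qed.

Lemma W2dist_sq_le (mu nu : W2 d) pi : coupling mu nu pi ->
  ((W2dist mu nu) ^+ 2)%:E <= transport_cost pi.
Proof. by move=> h; rewrite W2dist_sqE; apply: ereal_inf_lbound; exists pi. Qed.

Lemma le_W2dist_sq (mu nu : W2 d) c :
  (forall pi, coupling mu nu pi -> c <= transport_cost pi) ->
  c <= ((W2dist mu nu) ^+ 2)%:E.
Proof.
move=> h; rewrite W2dist_sqE; apply: le_ereal_inf_tmp => _ [pi cpi <-]; exact: h.
Qed.

(** The moment of [nu] is controlled through an arbitrary coupling with [nu0]. This serves to show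
    that all barycenter costs are finite. *)
Lemma W2dist_sq_le_moments (mu nu nu0 : W2 d) (x0 : X) :
  ((W2dist mu nu) ^+ 2)%:E <=
  2%:E * (\int[mu]_x ((d x0 x) ^+ 2)%:E +
          2%:E * (\int[nu0]_x ((d x0 x) ^+ 2)%:E + ((W2dist nu0 nu) ^+ 2)%:E)).
Proof.
have [pi cpi] := coupling_nonempty mu nu.
apply: (le_trans (W2dist_sq_le cpi)).
apply: (le_trans (transport_cost_le cpi x0)).
rewrite lee_wpmul2l// ?lee_fin// leeD2l//.
have fm (m : W2 d) : \int[m]_x ((d x0 x) ^+ 2)%:E \is a fin_num.
  rewrite ge0_fin_numE ?W2_moment_lty// integral_ge0// => x _.
  by rewrite lee_fin sqr_ge0.
rewrite -lee_pdivrMl// -leeBlDl//; apply: le_W2dist_sq => pi' cpi'.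
rewrite leeBlDl// lee_pdivrMl//; exact: moment_le_transport_cost.
Qed.

End wasserstein.

(** * Borel sets of the Wasserstein space *)

Section wasserstein_borel.
Context (R : realType) (X : pmetricType R).
Local Notation d := (@mdist R X).
Local Notation BX := (borel d).
Context (D : X^nat) (Dd : dense_seq D).

(** The points at distance at least [r] from the complement of [U], a closed set. *)
Definition deep_inside (U : set X) (r : R) : set X :=
  ~` [set x | exists2 y, ~ U y & (d y x < r)%R].

Lemma measurable_deep_inside U r : measurable (deep_inside U r : set BX).
Proof.
apply: measurableC; apply: borel_dist_open => x [y Uy yx].
have [e e0 h] := ball_dist_open (eq_ind_r (fun A : set X => A x) yx (ballEmdist y r)).
by exists e => // z /h; rewrite ballEmdist /= => yz; exists y.
Qed.

Lemma deep_inside_cvg (m : probability BX R) U : dist_open d U ->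
  m (deep_inside U (n.+1%:R^-1)) @[n --> \oo] --> m U.
Proof.
move=> oU.
have UE : U = \bigcup_n deep_inside U (n.+1%:R^-1).
  apply/seteqP; split => [x Ux|x [n _ h]].
    have [r r0 h] := oU x Ux.
    have [n _ nr] := @near_infty_natSinv_lt R (PosNum r0).
    exists n => // -[y Uy yx]; apply: Uy; apply: h.
    by rewrite metric_sym (lt_trans yx)//; apply: (nr n) => /=.
  by apply: contrapT => Ux; apply: h; exists x => //; rewrite mdistxx.
rewrite [X in _ --> m X]UE; apply: nondecreasing_cvg_mu.
- by move=> n; exact: measurable_deep_inside.
- by apply: bigcupT_measurable => n; exact: measurable_deep_inside.
- move=> i j ij; apply/subsetPset => x + [y Uy yx]; apply; exists y => //.
  by rewrite (lt_le_trans yx)// lef_pV2 ?posrE// ler_nat.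
Qed.

(** Lower semicontinuity of nu -> nu(U). By Markov, a coupling of cost below s^2 (m - c) moves less
    than m - c of mass by [s] or more; mass that starts in [deep_inside U s] and moves by less than
    [s] ends in [U]. *)
Lemma W2_gt_dist_open (U : set X) (c : R) : dist_open d U ->
  dist_open (@W2dist R X d) [set nu | c%:E < nu U].
Proof.
move=> oU mu /= cmu.
have [n cn] : exists n, c%:E < mu (deep_inside U (n.+1%:R^-1)).
  apply: contrapT => /forallNP h; move: cmu; apply/negP; rewrite -leNgt.
  rewrite -(cvg_lim _ (@deep_inside_cvg mu U oU))//.
  apply: lime_le; first by apply/cvg_ex; eexists; exact: deep_inside_cvg.
  by apply: nearW => n; rewrite leNgt; apply/negP.
set s := (n.+1%:R^-1 : R)%R in cn.
have s0 : (0 < s)%R by rewrite invr_gt0.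
have mF := measurable_deep_inside U s.
have mufin : mu (deep_inside U s) \is a fin_num by apply: fin_num_measure.
pose m := fine (mu (deep_inside U s)).
have mE : mu (deep_inside U s) = m%:E by rewrite fineK.
rewrite mE lte_fin in cn.
exists (s * Num.sqrt (m - c))%R; first by rewrite mulr_gt0// sqrtr_gt0 subr_gt0.
move=> nu munu.
have W0 : (0 <= W2dist mu nu)%R by exact: sqrtr_ge0.
have : ((W2dist mu nu) ^+ 2)%:E < (s ^+ 2 * (m - c))%:E.
  rewrite lte_fin -[X in (_ * X)%R](@sqr_sqrtr _ (m - c)%R) ?subr_ge0 ?ltW//.
  by rewrite -exprMn ltr_pXn2r// nnegrE// mulr_ge0// ?sqrtr_ge0// ltW.
rewrite (W2dist_sqE Dd) => /ereal_inf_lt[_ [pi cpi <-]] costs.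
have mfar : measurable [set z : BX * BX | (s ^+ 2 <= (d z.1 z.2) ^+ 2)%R].
  rewrite -[X in measurable X]setTI -preimage_itvcy.
  by apply: (measurable_funX 2 (measurable_mdist Dd)).
have far : pi [set z | (s ^+ 2 <= (d z.1 z.2) ^+ 2)%R] < (m - c)%:E.
  have := @markov_ge0 _ _ _ pi (fun z => (d z.1 z.2) ^+ 2)%R setT (s ^+ 2)%R
    measurableT (measurable_funX 2 (measurable_mdist Dd)).
  rewrite setTI => /(_ (fun _ => sqr_ge0 _) (sqr_ge0 _)).
  move=> /le_lt_trans/(_ costs); rewrite [X in _ < X]EFinM lte_pmul2l//.
  by rewrite lte_fin exprn_gt0.
rewrite -(cpi.2 _ (borel_dist_open oU)) /pushforward.
have mU : measurable (snd @^-1` U : set (BX * BX)).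
  rewrite -[X in measurable X]setTI; apply: measurable_snd => //.
  exact: borel_dist_open.
have : m%:E <= pi (snd @^-1` U) + pi [set z | (s ^+ 2 <= (d z.1 z.2) ^+ 2)%R].
  rewrite -mE -(cpi.1 _ mF) /pushforward.
  apply: le_trans (measureU2 _ mU mfar); apply: le_measure; rewrite ?inE.
  - by rewrite -[X in measurable X]setTI; exact: measurable_fst.
  - exact: measurableU.
  - move=> [x y] /= Fx; have [|xy] := leP (s ^+ 2)%R (d x y ^+ 2)%R; [by right|left].
    apply: contrapT => Uy; apply: Fx; exists y => //.
    by move: xy; rewrite ltr_pXn2r ?nnegrE ?mdist_ge0 ?ltW// metric_sym.
have farfin : pi [set z | (s ^+ 2 <= (d z.1 z.2) ^+ 2)%R] \is a fin_num.
  by apply: fin_num_measure.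
have Ufin : pi (snd @^-1` U) \is a fin_num by apply: fin_num_measure.
rewrite -(fineK farfin) -(fineK Ufin) -EFinD lte_fin lee_fin.
by move: far; rewrite -(fineK farfin) lte_fin; lra.
Qed.

Section modulus.
Context (Y : pseudoMetricType R) (f : X -> Y).
Hypothesis fo : forall c r, dist_open d (f @^-1` ball c r).

(** A quantitative form of absolute continuity of the image of [nu] under [f]. Under [fo] it bounds
    the measure of open sets, hence is a closed condition on [nu]. *)
Definition modulus_set (eps : R) (n : nat) : set (W2 d) :=
  [set nu | forall c r, (forall i, (0 <= r i)%R) ->
    \sum_(i <oo) (r i)%:E <= ((n.+1)%:R^-1)%:E ->
    nu (f @^-1` (ball_cover c r)) <= eps%:E].

Lemma dist_open_preimage_cover c r : dist_open d (f @^-1` (ball_cover c r)).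
Proof.
move=> x [i _ /fo[e e0 h]]; exists e => // y /h fy; by exists i.
Qed.

Lemma measurable_modulus_set eps n :
  measurable (modulus_set eps n : set (borel (@W2dist R X d))).
Proof.
rewrite -[modulus_set _ _]setCK; apply: measurableC; apply: sub_sigma_algebra.
move=> mu /existsNP[c] /existsNP[r] /not_implyP[r0] /not_implyP[rs] /negP.
rewrite -ltNge => h.
have [e e0 he] := W2_gt_dist_open (@dist_open_preimage_cover c r) h.
by exists e => // nu /he /=; rewrite ltNge => /negP nuU /(_ c r r0 rs).
Qed.

Lemma null_modulus_set (nu : W2 d) eps :
  (forall N : set Y, measurable (f @^-1` N : set BX) -> ball_null N -> nu (f @^-1` N) = 0) ->
  (0 < eps)%R -> exists n, modulus_set eps n nu.
Proof.
move=> null e0.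
have [|c r|n h] := @null_preimage_modulus _ BX R Y f nu eps _ _ null e0.
- by rewrite -ge0_fin_numE//; apply: fin_num_measure.
- by apply: borel_dist_open; exact: fo.
- by exists n.
Qed.

End modulus.

(* [nu] is absolutely continuous iff for every [k] there is [n] such that [nu] is
   at most [1 / (k + 1)] on the unions of balls of total radius at most
   [1 / (n + 1)], and each of these conditions is closed. *)
Lemma measurable_W2ac : measurable ([set nu : W2 d |
  nu `<< (@hausdorff1 R X : set BX -> \bar R)] : set (borel (@W2dist R X d))).
Proof.
have ido c r : dist_open d (@idfun X @^-1` ball c r) by exact: ball_dist_open.
rewrite [X in measurable X](_ : _ =
    \bigcap_k \bigcup_n (modulus_set (@idfun X) (k.+1%:R^-1) n)).
  apply: bigcapT_measurable => k; apply: bigcupT_measurable => n.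
  exact: measurable_modulus_set.
apply/seteqP; split => nu /=.
  move=> /null_dominates_hausdorff1P h k _.
  have [n hn] := @null_modulus_set X idfun ido nu (k.+1%:R^-1)%R h ltac:(by []).
  by exists n.
move=> h; apply/null_dominates_hausdorff1P => A mA A0.
apply/eqP; rewrite eq_le measure_ge0 andbT.
apply/lee_addgt0Pr => e e0; rewrite add0e.
have [k _ ke] := @near_infty_natSinv_lt R (PosNum e0).
have [n _ hn] := h k I.
have [c [r [r0 rs Acov]]] := A0 (n.+1%:R^-1)%R ltac:(by []).
apply: (@le_trans _ _ (nu (ball_cover c r))).
  apply: le_measure; rewrite ?inE//; apply: borel_dist_open.
  exact: (dist_open_preimage_cover ido).
by apply: (le_trans (hn c r r0 rs)); rewrite lee_fin ltW//; apply: (ke k) => /=.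
Qed.

End wasserstein_borel.

(** * Geometry along an edge *)

Section edge_geometry.
Local Open Scope ring_scope.
Context (R : realType) (V : countType) (Gr : metric_graph R V).
Local Notation G := (mgspace Gr).
Implicit Types (e : edges Gr) (x y : G).

Lemma clamp_subproof e (s : R) :
  Num.max 0 (Num.min s (len e)) \in [set` `[0, len e]].
Proof.
rewrite inE/= in_itv/= le_max lexx/= ge_max len_ge0/=.
by rewrite ge_min lexx orbT.
Qed.

(** Clamping makes [line] a contraction defined on the whole real line. *)
Definition clamp e (s : R) : segment e :=
  exist _ (Num.max 0 (Num.min s (len e))) (clamp_subproof e s).

Definition line e (s : R) : G := pt (clamp e s).

Lemma clampE e (s : segment e) : clamp e (val s) = s.
Proof.
apply: val_inj => /=; have /andP[s0 sl] := seg_itv s.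
by rewrite (min_idPl sl) (max_idPr s0).
Qed.

Lemma ptE e (s : segment e) : pt s = line e (val s).
Proof. by rewrite /line clampE. Qed.

Lemma line_itv e (u : R) : 0 <= u <= len e -> val (clamp e u) = u.
Proof. by move=> /andP[u0 ul] /=; rewrite (min_idPl ul) (max_idPr u0). Qed.

Lemma le_mdist_pt e (s t : segment e) : mdist (pt s) (pt t) <= `|val s - val t|.
Proof. by rewrite mdist_mgspaceE; apply: mgdist_le; exact: path_length1. Qed.

Lemma line_contraction e (s t : R) : mdist (line e s) (line e t) <= `|s - t|.
Proof.
apply: (le_trans (le_mdist_pt _ _)) => /=.
have := len_ge0 e; move: (len e) => l l0.
rewrite ler_norml; have := ler_norm (s - t); have := ler_norm (t - s).
rewrite (distrC t s).
by rewrite !maxEle !minEle; do ! case: ifPn; rewrite -?ltNge; move=> *;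
  apply/andP; split; lra.
Qed.

Definition org_pt e : G := pt (seg0 e).
Definition dst_pt e : G := pt (segl e).

Lemma org_neq_dst e : org e != dst e.
Proof.
apply/eqP => h; have := edge_card (set_valP e).
by rewrite -[X in #|` X|]/(val e) edge_ends h fsetUid cardfs1.
Qed.

(** Only vertices are glued, and the two ends of an edge are distinct since there are no loops. *)
Lemma pt_inj e : injective (@pt R V Gr e).
Proof.
move=> s t /eqmodP; rewrite /= /Defs.glue => /orP[/eqP h|]; first exact: eq_from_Tagged h.
have vst : val s = val t -> s = t by exact: val_inj.
case: (at_vertexP (Tagged _ s)) => //= sc;
  case: (at_vertexP (Tagged _ t)) => //= tc /eqP h; apply: vst.
- by rewrite -[val s]/(position (Tagged (@segment _ _ Gr) s)) sc.
- by case: h => h; move: (org_neq_dst e); rewrite h eqxx.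
- by case: h => h; move: (org_neq_dst e); rewrite h eqxx.
- by rewrite -[val s]/(position (Tagged (@segment _ _ Gr) s)) sc.
Qed.

(** Either the path stays in [e], or it first leaves [e] through one end, and the rest is at least
    as long as the distance from this end to [y]. *)
Lemma path_cases x y L : path_length x y L -> forall e (s : segment e), x = pt s ->
  [\/ exists2 t : segment e, y = pt t & `|val s - val t| <= L,
      val s + mdist (org_pt e) y <= L |
      len e - val s + mdist (dst_pt e) y <= L].
Proof.
elim=> [{}x e s xs|e0 s0 t0 {}y {}L pL ih e s].
  by apply: Or31; exists s => //; rewrite subrr normr0.
move=> xs; have : Defs.glue (Tagged (@segment _ _ Gr) s0) (Tagged (@segment _ _ Gr) s).
  by move/eqmodP : xs.
(* Either the first segment lies on [e], or [x] is a vertex, thus an end of [e], with [val s] equal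
   to 0 or [len e]. *)
rewrite /Defs.glue => /orP[/eqP h|].
  have ee : e0 = e by move/(congr1 tag) : h.
  subst e0; have ss := eq_from_Tagged h; subst s0.
  have [[t yt h1]|h1|h1] := ih e t0 erefl.
  - apply: Or31; exists t => //; apply: (le_trans (ler_distD (val t0) _ _)).
    by rewrite lerD2l.
  - by apply: Or32; have := ler_norm (val s - val t0); lra.
  - by apply: Or33; have := ler_norm (val t0 - val s); rewrite distrC; lra.
have dL : mdist (pt s) y <= `|val s0 - val t0| + L.
  by rewrite -xs mdist_mgspaceE; apply: mgdist_le; exact: path_cons.
move=> /andP[v0 /eqP vs]; rewrite vs in v0; move: v0.
have vst u : val s = val u -> s = u by exact: val_inj.
case: (at_vertexP (Tagged _ s)) => // sc _.
  have -> : val s = 0 by exact: sc.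
  apply: Or32; rewrite add0r /org_pt -(vst (seg0 e))//; exact: sc.
have -> : val s = len e by exact: sc.
apply: Or33; rewrite subrr add0r /dst_pt -(vst (segl e))//; exact: sc.
Qed.

Lemma mdist_org_pt e (s : segment e) : mdist (org_pt e) (pt s) <= val s.
Proof.
apply: (le_trans (le_mdist_pt _ _)) => /=.
by rewrite sub0r normrN ger0_norm//; have /andP[] := seg_itv s.
Qed.

Lemma mdist_dst_pt e (s : segment e) : mdist (dst_pt e) (pt s) <= len e - val s.
Proof.
apply: (le_trans (le_mdist_pt _ _)) => /=.
by rewrite ger0_norm// subr_ge0; have /andP[] := seg_itv s.
Qed.

Lemma mdist_le_org e (s : segment e) y :
  mdist (pt s) y <= val s + mdist (org_pt e) y.
Proof.
apply: (le_trans (metric_triangle _ (org_pt e) _)); rewrite lerD2r metric_sym.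
exact: mdist_org_pt.
Qed.

Lemma mdist_le_dst e (s : segment e) y :
  mdist (pt s) y <= len e - val s + mdist (dst_pt e) y.
Proof.
apply: (le_trans (metric_triangle _ (dst_pt e) _)); rewrite lerD2r metric_sym.
exact: mdist_dst_pt.
Qed.

(** Each quantity bounds the distance from above, and by [path_cases] every path is at least as long
    as one of them; so the distance is their minimum. *)
Lemma mdist_cases e (s : segment e) y :
  [\/ exists2 t : segment e, y = pt t & mdist (pt s) y = `|val s - val t|,
      mdist (pt s) y = val s + mdist (org_pt e) y |
      mdist (pt s) y = len e - val s + mdist (dst_pt e) y].
Proof.
pose p := val s + mdist (org_pt e) y.
pose q := len e - val s + mdist (dst_pt e) y.
have [[t yt]|yt] := pselect (exists t : segment e, y = pt t).
  pose c := Num.min `|val s - val t| (Num.min p q).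
  have : mdist (pt s) y = c.
    apply/eqP; rewrite eq_le !le_min mdist_le_org mdist_le_dst yt le_mdist_pt/=.
    rewrite mdist_mgspaceE; apply: le_mgdist => L pL.
    have [[t' /pt_inj <- h]|h|h] := path_cases pL erefl; rewrite /c !ge_min.
    - by rewrite h.
    - by rewrite /p yt h orbT.
    - by rewrite /q yt h !orbT.
  rewrite /c !minEle; case: ifP => _; first by move=> ?; apply: Or31; exists t.
  by case: ifP => _ ?; [apply: Or32|apply: Or33].
have : mdist (pt s) y = Num.min p q.
  apply/eqP; rewrite eq_le !le_min mdist_le_org mdist_le_dst/=.
  rewrite mdist_mgspaceE; apply: le_mgdist => L pL.
  have [[t' yt' h]|h|h] := path_cases pL erefl; rewrite !ge_min.
  - by exfalso; apply: yt; exists t'.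
  - by rewrite /p h.
  - by rewrite /q h orbT.
by rewrite minEle; case: ifP => _ ?; [apply: Or32|apply: Or33].
Qed.

Lemma mdist_org_dst_gt0 e : 0 < mdist (org_pt e) (dst_pt e).
Proof.
rewrite mdist_gt0; apply/eqP => /pt_inj /(congr1 val) /= h.
by have := len_gt0 e; rewrite -h ltxx.
Qed.

Lemma mdist_near e (s : segment e) y :
  mdist (pt s) y < Num.min (val s) (len e - val s) ->
  exists2 t : segment e, y = pt t & mdist (pt s) y = `|val s - val t|.
Proof.
rewrite lt_min => /andP[h1 h2]; have [//|h|h] := mdist_cases s y.
- by move: h1; rewrite h gtrDl ltNge mdist_ge0.
- by move: h2; rewrite h gtrDl ltNge mdist_ge0.
Qed.

(* The smaller of the distances from a point of [e] to the two ends is always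
   attained along [e]. *)
Definition pos e y : R :=
  if mdist (org_pt e) y <= mdist (dst_pt e) y then mdist (org_pt e) y
  else len e - mdist (dst_pt e) y.

(** A route from one end to [pt s] through the other end is strictly longer than the distance from
    that other end, because the ends are at positive distance. So the smaller distance is measured
    along [e]. *)
Lemma pos_pt e (s : segment e) : pos e (pt s) = val s.
Proof.
rewrite /pos.
have D0 := mdist_org_dst_gt0 e.
have Dl : mdist (org_pt e) (dst_pt e) <= len e by exact: mdist_org_pt.
have /andP[s0 sl] := seg_itv s.
have a1 := mdist_org_pt s; have b1 := mdist_dst_pt s.
have a2 : mdist (org_pt e) (pt s) = val s \/
    mdist (org_pt e) (pt s) = len e - val s + mdist (org_pt e) (dst_pt e).
  rewrite metric_sym; have [[t /pt_inj <- /= ->]|->|->] := mdist_cases s (org_pt e).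
  - by left; rewrite subr0 ger0_norm.
  - by left; rewrite mdistxx addr0.
  - by right; rewrite (metric_sym (dst_pt e)).
have b2 : mdist (dst_pt e) (pt s) = len e - val s \/
    mdist (dst_pt e) (pt s) = val s + mdist (org_pt e) (dst_pt e).
  rewrite metric_sym; have [[t /pt_inj <- /= ->]|->|->] := mdist_cases s (dst_pt e).
  - by left; rewrite distrC ger0_norm// subr_ge0.
  - by right.
  - by left; rewrite mdistxx addr0.
have a3 := mdist_le_dst s (org_pt e).
rewrite (metric_sym (pt s)) (metric_sym (dst_pt e)) in a3.
have b3 := mdist_le_org s (dst_pt e); rewrite (metric_sym (pt s)) in b3.
case: ifPn; rewrite -?ltNge => h.
- by case: a2 => // a2; case: b2 => b2; lra.
- by case: b2 => b2; [lra|case: a2 => a2; lra].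
Qed.

(* Coordinate on the line containing [e] that is reached from [x], a point of
   [e], by a shortest path to [y]. *)
Definition unroll e x y : R :=
  if mdist x y == pos e x + mdist (org_pt e) y then - mdist (org_pt e) y
  else if mdist x y == len e - pos e x + mdist (dst_pt e) y
       then len e + mdist (dst_pt e) y
  else pos e y.

Lemma mdist_unroll e (s : segment e) y :
  mdist (pt s) y = `|val s - unroll e (pt s) y|.
Proof.
have /andP[s0 sl] := seg_itv s.
have a0 := mdist_ge0 (org_pt e) y; have b0 := mdist_ge0 (dst_pt e) y.
rewrite /unroll pos_pt; case: eqP => [->|n1].
  by rewrite ger0_norm; lra.
case: eqP => [->|n2]; first by rewrite distrC ger0_norm; lra.
by have [[t -> ->]|//|//] := mdist_cases s y; rewrite pos_pt.
Qed.

(** The route chosen for [pt s], followed from [pt s'] instead, has this length. *)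
Lemma mdist_le_unroll e (s s' : segment e) y :
  mdist (pt s') y <= `|val s' - unroll e (pt s) y|.
Proof.
have /andP[s0 sl] := seg_itv s'.
have a0 := mdist_ge0 (org_pt e) y; have b0 := mdist_ge0 (dst_pt e) y.
rewrite /unroll pos_pt; case: eqP => [_|n1].
  by rewrite ger0_norm ?opprK ?addr_ge0//; exact: mdist_le_org.
case: eqP => [_|n2].
  rewrite distrC ger0_norm; last by lra.
  by apply: (le_trans (mdist_le_dst _ _)); lra.
have [[t -> _]|//|//] := mdist_cases s y; rewrite pos_pt; exact: le_mdist_pt.
Qed.

(** Up to four cases, the coordinate is determined by the distances from [y] to the two ends, so its
    concentration can be read on the law of [y]. *)
Lemma unroll_cases e x y :
  [\/ unroll e x y = mdist (org_pt e) y, unroll e x y = - mdist (org_pt e) y,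
      unroll e x y = len e - mdist (dst_pt e) y |
      unroll e x y = len e + mdist (dst_pt e) y].
Proof.
rewrite /unroll /pos; case: ifP => _; first exact: Or42.
case: ifP => _; first exact: Or44.
by case: ifP => _; [exact: Or41|exact: Or43].
Qed.

End edge_geometry.

(** * Measurability and null sets on the graph *)

Section graph_borel.
Local Open Scope ring_scope.
Context (R : realType) (V : countType) (Gr : metric_graph R V).
Local Notation G := (mgspace Gr).
Local Notation BG := (mgborel Gr).
Implicit Types (e : edges Gr) (x y : G).

Definition nth_edge n : option (edges Gr) :=
  if @choice.unpickle {fset V} n is Some F then
    if pselect (edges Gr F) is left h then Some (exist _ F (mem_set h)) else None
  else None.

Lemma nth_edgeP (e : edges Gr) : exists n, nth_edge n = Some e.
Proof.
exists (choice.pickle (val e)); rewrite /nth_edge choice.pickleK.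
case: pselect => [h|/(_ (set_valP e))//].
by congr Some; exact: val_inj.
Qed.

Definition graph_dense (n : nat) : G :=
  if @choice.unpickle (nat * rat)%type n is Some (i, q) then
    if nth_edge i is Some e then line e (ratr q) else point
  else point.

Lemma graph_denseP : dense_seq graph_dense.
Proof.
move=> x r r0; have [e [s ->]] := ptP x; have [i ie] := nth_edgeP e.
have /rat_in_itvoo[q qs] : val s - r < val s + r by lra.
have /andP[q1 q2] : val s - r < ratr q < val s + r by move: qs; rewrite in_itv.
exists (choice.pickle (i, q)); rewrite /graph_dense choice.pickleK ie.
rewrite ptE; apply: (le_lt_trans (line_contraction _ _ _)).
rewrite ltr_norml; apply/andP; split; lra.
Qed.

Lemma measurable_line e : measurable_fun setT (line e : R -> BG).
Proof. by apply: contraction_measurable; exact: line_contraction. Qed.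

Lemma measurable_pos e : measurable_fun setT (pos e : BG -> R).
Proof.
have m1 := @measurable_mdistr R G (org_pt e).
have m2 := @measurable_mdistr R G (dst_pt e).
apply: measurable_fun_ifT => //; first exact: measurable_fun_ler.
exact: measurable_funB.
Qed.

Lemma measurable_unroll e :
  measurable_fun setT (fun z : BG * BG => unroll e z.1 z.2).
Proof.
have m1 : measurable_fun setT (fun z : BG * BG => mdist (org_pt e) z.2).
  exact: (measurableT_comp (@measurable_mdistr R G (org_pt e)) measurable_snd).
have m2 : measurable_fun setT (fun z : BG * BG => mdist (dst_pt e) z.2).
  exact: (measurableT_comp (@measurable_mdistr R G (dst_pt e)) measurable_snd).
have m3 : measurable_fun setT (fun z : BG * BG => pos e z.1).
  exact: (measurableT_comp (measurable_pos e) measurable_fst).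
have m4 : measurable_fun setT (fun z : BG * BG => pos e z.2).
  exact: (measurableT_comp (measurable_pos e) measurable_snd).
have md := measurable_mdist graph_denseP.
have ml (c : R) : measurable_fun setT (fun z : BG * BG => c).
  exact: measurable_cst.
apply: measurable_fun_ifT.
- apply: measurable_fun_eqr; [exact: md|exact: (measurable_funD m3 m1)].
- by apply: measurableT_comp m1.
apply: measurable_fun_ifT.
- apply: measurable_fun_eqr; first exact: md.
  exact: (measurable_funD (measurable_funB (ml (len e)) m3) m2).
- exact: (measurable_funD (ml (len e)) m2).
- exact: m4.
Qed.

(** In the core a shift by at most [r] stays in the edge, and distances below [r] are differences of
    positions. *)
Definition edge_core e (r : R) : set G :=
  edge_interior e `&` (pos e @^-1` [set` `[r, len e - r]]).

Lemma measurable_edge_core e r : measurable (edge_core e r : set BG).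
Proof.
apply: measurableI; first exact: edge_interior_measurable.
rewrite -[X in measurable X]setTI; apply: measurable_pos => //.
Qed.

Lemma edge_interior_bigcup_core e :
  edge_interior e = \bigcup_n edge_core e (n.+1%:R^-1).
Proof.
apply/seteqP; split => [x [s /andP[s0 sl] ->]|x [n _ []//]].
have m0 : 0 < Num.min (val s) (len e - val s) by rewrite lt_min s0 subr_gt0.
have [n _ /(_ n (leqnn n)) /= h] := @near_infty_natSinv_lt R (PosNum m0).
move: h; rewrite lt_min => /andP[h1 h2].
exists n => //; split; first by exists s => //; rewrite s0.
rewrite /= in_itv/= pos_pt; apply/andP; split; first exact: ltW.
by rewrite lerBrDr -lerBrDl; exact: ltW.
Qed.

Lemma edge_core_isometry e r x y : edge_core e r x -> edge_core e r y ->
  mdist x y < r -> mdist x y = `|pos e x - pos e y|.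
Proof.
move=> [[s _ ->]] /=; rewrite pos_pt in_itv/= => /andP[s1 s2] [[t _ ->]] /= _ h.
have [|t' /pt_inj <-] := @mdist_near _ _ _ e s (pt t); last by rewrite !pos_pt.
rewrite lt_min; rewrite /= in h *; apply/andP; split; lra.
Qed.

Lemma ball_null_edges (S : edges Gr -> set G) : (forall e, ball_null (S e)) ->
  ball_null (\bigcup_e S e).
Proof.
move=> h; pose T n := if nth_edge n is Some e then S e else set0.
apply: (@sub_ball_null _ _ _ (\bigcup_n T n)).
  by move=> x [e _ Sx]; have [n ne] := nth_edgeP e; exists n; rewrite // /T ne.
apply: ball_null_bigcup => n; rewrite /T; case: nth_edge => [e|]; first exact: h.
by have [e _] := ptP (point : G); apply: sub_ball_null (h e).
Qed.

(** The set lies in the image of [N] under the contraction s -> line e (g s), which maps covers to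
    covers with the same radii. *)
Lemma ball_null_along_line e (f : G -> R) (g : R -> R) (N : set R) :
  (forall s t, `|g s - g t| <= `|s - t|) -> ball_null N ->
  ball_null [set y | N (f y) /\ y = line e (g (f y))].
Proof.
move=> gl N0 eta eta0; have [c [r [r0 rs Nc]]] := N0 _ eta0.
exists (fun i => line e (g (c i))), r; split => // y [/Nc[i _ fi] ->].
exists i => //; rewrite ballEmdist /=.
apply: (le_lt_trans (line_contraction _ _ _)).
exact: (le_lt_trans (gl _ _)).
Qed.

(** A shortest path from [y] to [v] leaves the edge of [y] through either end, or stays in it on one
    side of [v]; in each case [y] is a contraction of its distance to [v]. Hence an absolutely
    continuous measure gives this distance an absolutely continuous law. *)
Lemma ball_null_preimage_mdist (v : G) (N : set R) : ball_null N ->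
  ball_null (mdist v @^-1` N).
Proof.
move=> N0.
pose f (y : G) := mdist v y.
have [ev [sv vE]] := ptP v.
(* The last two branches serve when [v] lies on [e]; every [b] from 3 on repeats the last one. *)
pose g e (b : nat) : R -> R := match b with
  | 0%N => fun z => z - mdist (org_pt e) v
  | 1%N => fun z => len e + mdist (dst_pt e) v - z
  | 2%N => fun z => pos e v + z
  | _ => fun z => pos e v - z end.
have gl e b s t : `|g e b s - g e b t| <= `|s - t|.
  have [->//|->] : g e b s - g e b t = s - t \/ g e b s - g e b t = t - s.
    by case: b => [|[|[|b]]] /=; [left|right|left|right]; lra.
  by rewrite distrC.
pose S e := \bigcup_b [set y | N (f y) /\ y = line e (g e b (f y))].
apply: (@sub_ball_null _ _ _ (\bigcup_e S e)); last first.
  by apply: ball_null_edges => e; apply: ball_null_bigcup => b; exact: ball_null_along_line.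
move=> y /= Ny; have [e [s yE]] := ptP y; exists e => //.
have fy : f y = mdist (pt s) v by rewrite /f yE metric_sym.
have [[t vt h]|h|h] := mdist_cases s v.
- have pv : pos e v = val t by rewrite vt pos_pt.
  have [st|st] := leP (val s) (val t).
    exists 3%N => //; split => //=; rewrite fy h pv yE ptE; congr line.
    by rewrite ler0_norm; lra.
  exists 2%N => //; split => //=; rewrite fy h pv yE ptE; congr line.
  by rewrite gtr0_norm; lra.
- by exists 0%N => //; split => //=; rewrite fy h yE ptE addrK.
- exists 1%N => //; split => //=; rewrite fy h yE ptE; congr line; lra.
Qed.

End graph_borel.

(** * Resampling of pairs *)

Section mpush.
Context d1 d2 (T1 : measurableType d1) (T2 : measurableType d2) (R : realType).
Variables (m : {measure set T1 -> \bar R}) (f : T1 -> T2).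
Hypothesis mf : measurable_fun setT f.

Definition mpush : {measure set T2 -> \bar R}.
Proof. by unshelve refine (pushforward m f : {measure set T2 -> \bar R}). Defined.

Lemma ge0_integral_mpush (h : T2 -> \bar R) : measurable_fun setT h ->
  (forall y, 0 <= h y) -> \int[mpush]_y h y = \int[m]_x h (f x).
Proof.
by move=> mh h0; rewrite ge0_integral_pushforward.
Qed.
End mpush.

Section resample.
Context d (T : measurableType d) (R : realType) (m : probability T R).
Variables (K : nat) (J : (set T)^nat) (w : {nonneg R}^nat) (f g : nat -> T * T -> T).
Hypotheses (mJ : forall k, measurable (J k)) (tJ : trivIset setT J).
Hypotheses (mf : forall k, measurable_fun setT (f k))
           (mg : forall k, measurable_fun setT (g k)).

Definition unselected := ~` \big[setU/set0]_(k < K) J k.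

Lemma measurable_unselected : measurable unselected.
Proof. by apply: measurableC; exact: bigsetU_measurable. Qed.

Lemma measurable_square k : measurable (J k `*` J k).
Proof. exact: measurableX. Qed.

Let pairs k : {measure set (T * T) -> \bar R} := mrestr (m \x m) (measurable_square k).

Let block k : {measure set T -> \bar R} :=
  mscale (w k) (measure_add (mpush (pairs k) (mf k)) (mpush (pairs k) (mg k))).

(** Keeps [m] off the first [K] blocks and replaces it on [J k] by [w k] times the sum of the laws
    of [f k] and [g k] at two independent points of [J k]. The space is general because this is
    applied both to [mu] and to a coupling. *)
Definition resample : {measure set T -> \bar R} :=
  measure_add (mrestr m measurable_unselected) (msum block K).

Lemma ge0_integral_resample (h : T -> \bar R) : measurable_fun setT h ->
  (forall x, 0 <= h x) ->
  \int[resample]_x h x = \int[m]_(x in unselected) h x +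
    \sum_(k < K) (w k)%:num%:E *
      \int[m \x m]_(p in J k `*` J k) (h (f k p) + h (g k p)).
Proof.
move=> mh h0; rewrite ge0_integral_measure_add// ge0_integral_mrestr//.
rewrite ge0_integral_measure_sum//; congr (_ + _); apply: eq_bigr => k _.
rewrite ge0_integral_mscale//; congr (_ * _).
rewrite ge0_integral_measure_add// !ge0_integral_mpush// !ge0_integral_mrestr//.
- rewrite -ge0_integralD//; last 3 first.
  + exact: measurable_square.
  + by apply: measurable_funTS; exact: measurableT_comp.
  + by apply: measurable_funTS; exact: measurableT_comp.
- exact: measurableT_comp.
- exact: measurableT_comp.
Qed.

Lemma integral_square_sum k (h : T -> \bar R) : measurable_fun setT h ->
  (forall x, 0 <= h x) ->
  \int[m \x m]_(p in J k `*` J k) (h p.1 + h p.2) =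
    m (J k) * \int[m]_(x in J k) h x + m (J k) * \int[m]_(x in J k) h x.
Proof.
move=> mh h0; rewrite ge0_integralD//; last 3 first.
- exact: measurable_square.
- by apply: measurable_funTS; exact: measurableT_comp mh measurable_fst.
- by apply: measurable_funTS; exact: measurableT_comp mh measurable_snd.
pose hJ := h \_ (J k).
have mhJ : measurable_fun setT hJ.
  by apply/(measurable_restrictT _ (mJ k)); exact: measurable_funTS.
have hJ0 x : 0 <= hJ x by rewrite /hJ patchE; case: ifP.
have m1 : measurable_fun setT (fun p : T * T => hJ p.1 * (\1_(J k) p.2)%:E).
  apply: emeasurable_funM; first exact: measurableT_comp mhJ measurable_fst.
  by apply/measurable_EFinP; apply: measurableT_comp measurable_snd.
have m2 : measurable_fun setT (fun p : T * T => hJ p.2 * (\1_(J k) p.1)%:E).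
  apply: emeasurable_funM; first exact: measurableT_comp mhJ measurable_snd.
  by apply/measurable_EFinP; apply: measurableT_comp measurable_fst.
have e1 : \int[m \x m]_(p in J k `*` J k) h p.1 =
    \int[m \x m]_p (hJ p.1 * (\1_(J k) p.2)%:E).
  rewrite integral_mkcond; apply: eq_integral => -[x y] _.
  rewrite /hJ !patchE in_setX /= indicE.
  by case: (x \in J k); case: (y \in J k); rewrite /= ?mule1 ?mule0.
have e2 : \int[m \x m]_(p in J k `*` J k) h p.2 =
    \int[m \x m]_p (hJ p.2 * (\1_(J k) p.1)%:E).
  rewrite integral_mkcond; apply: eq_integral => -[x y] _.
  rewrite /hJ !patchE in_setX /= indicE.
  by case: (x \in J k); case: (y \in J k); rewrite /= ?mule1 ?mule0.
have inner x : \int[m]_y (hJ x * (\1_(J k) y)%:E) = hJ x * m (J k).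
  rewrite ge0_integralZl//; first by rewrite integral_indic// setIT.
  by apply/measurable_EFinP.
have outer : \int[m]_x (hJ x * m (J k)) = m (J k) * \int[m]_(x in J k) h x.
  by rewrite ge0_integralZr// muleC -integral_mkcond.
congr (_ + _).
- rewrite e1 fubini_tonelli1//; last by move=> p; rewrite mule_ge0// lee_fin.
  by rewrite -outer; apply: eq_integral => x _; exact: inner.
- rewrite e2 fubini_tonelli2//; last by move=> p; rewrite mule_ge0// lee_fin.
  by rewrite -outer; apply: eq_integral => x _; exact: inner.
Qed.

Hypothesis wE : forall k, (w k)%:num = ((fine (m (J k)) *+ 2)^-1)%R.

(** The square of [J k] counts each coordinate with the factor m(J k), so the weight 1 / (2 m(J k))
    restores [m] on [J k]. *)
Lemma weighted_square_sum k (h : T -> \bar R) : measurable_fun setT h ->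
  (forall x, 0 <= h x) ->
  (w k)%:num%:E * \int[m \x m]_(p in J k `*` J k) (h p.1 + h p.2) =
    \int[m]_(x in J k) h x.
Proof.
move=> mh h0; rewrite integral_square_sum// wE.
have fJ : m (J k) \is a fin_num by exact: fin_num_measure.
pose c := fine (m (J k)); have mc : m (J k) = c%:E by rewrite fineK.
rewrite -/c mc.
have [c1|c1] := eqVneq c 0%R.
  rewrite c1 !mul0e adde0 mule0; apply/esym.
  rewrite (ge0_negligible_integral (mJ k))//; last 2 first.
  - exact: measurable_funTS.
  - by apply: etrans mc _; rewrite c1.
  by rewrite setDv integral_set0.
have c0 : 0 <= c%:E by rewrite -mc measure_ge0.
rewrite -[X in _ * X]ge0_muleDl// -EFinD muleA -EFinM -mulr2n mulVf ?mul1e//.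
by rewrite mulrn_eq0.
Qed.

Lemma integral_split (h : T -> \bar R) : measurable_fun setT h ->
  (forall x, 0 <= h x) ->
  \int[m]_x h x = \int[m]_(x in unselected) h x +
    \sum_(k < K) \int[m]_(x in J k) h x.
Proof.
move=> mh h0.
have mU : measurable (\big[setU/set0]_(k < K) J k) by exact: bigsetU_measurable.
rewrite -(setUv (\big[setU/set0]_(k < K) J k)) ge0_integral_setU//; last 3 first.
- exact: measurableC.
- exact: measurable_funTS.
- by apply/disj_setPCl.
rewrite addeC; congr (_ + _).
rewrite -(big_mkord xpredT J) -(big_mkord xpredT (fun k => \int[m]_(x in J k) h x)).
rewrite ge0_integral_bigsetU//.
- exact: iota_uniq.
- exact: sub_trivIset tJ.
- exact: measurable_funTS.
Qed.

Lemma resample_setT : resample setT = 1.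
Proof.
rewrite -[LHS]mul1e -(integral_cst _ measurableT) ge0_integral_resample//.
transitivity (\int[m]_x cst 1 x); last first.
  by rewrite (integral_cst m measurableT) mul1e; exact: probability_setT.
rewrite integral_split//; congr (_ + _); apply: eq_bigr => k _.
by rewrite -(@weighted_square_sum k (cst 1)).
Qed.

Definition resample_prob : probability T R := mkprob resample_setT.

End resample.

(** * The competitor and its couplings *)

Lemma le_integralD_cst d (T : measurableType d) (R : realType)
    (m : {measure set T -> \bar R}) (D : set T) (f1 f2 g : T -> \bar R) (a c : R) :
  measurable D -> measurable_fun setT f1 -> measurable_fun setT f2 ->
  measurable_fun setT g ->
  (forall x, 0 <= f1 x) -> (forall x, 0 <= f2 x) -> (forall x, 0 <= g x) ->
  (0 <= a)%R -> (0 <= c)%R ->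
  (forall x, D x -> f1 x + a%:E * f2 x <= g x + c%:E) ->
  \int[m]_(x in D) f1 x + a%:E * \int[m]_(x in D) f2 x <=
    \int[m]_(x in D) g x + c%:E * m D.
Proof.
move=> mD mf1 mf2 mg f10 f20 g0 a0 c0 h.
have mf1D := measurable_funTS mf1 : measurable_fun D f1.
have mf2D := measurable_funTS mf2 : measurable_fun D f2.
have mgD := measurable_funTS mg : measurable_fun D g.
have maf2 : measurable_fun D (fun x => a%:E * f2 x) by exact: measurable_funeM.
rewrite -integral_cst// -ge0_integralZl//.
rewrite -ge0_integralD//; last by move=> x _; rewrite mule_ge0.
rewrite -ge0_integralD//.
apply: ge0_le_integral => //.
- by move=> x _; rewrite adde_ge0// mule_ge0.
- exact: emeasurable_funD.
- exact: emeasurable_funD.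
Qed.

Section product_coupling.
Context (R : realType) (X : pmetricType R).
Local Notation d := (@mdist R X).
Local Notation BX := (borel d).
Context (mu nu : W2 d) (pi : probability (BX * BX)%type R).
Hypothesis cpi : coupling mu nu pi.

Lemma coupling_integral_fst_in (U : set BX) (h : BX -> \bar R) : measurable U ->
  measurable_fun setT h -> (forall x, 0 <= h x) ->
  \int[pi]_(z in fst @^-1` U) h z.1 = \int[mu]_(x in U) h x.
Proof.
move=> mU mh h0; rewrite integral_mkcond [RHS]integral_mkcond.
rewrite -(coupling_integral_fst cpi); first by apply: eq_integral => z _; rewrite !patchE.
- by apply/(measurable_restrictT _ mU); exact: measurable_funTS.
- by move=> x; rewrite patchE; case: ifP.
Qed.

Definition firsts (p : (BX * BX) * (BX * BX)) : BX * BX := (p.1.1, p.2.1).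

Lemma measurable_firsts : measurable_fun setT firsts.
Proof.
apply/measurable_fun_pairP; split => /=.
  exact: (measurableT_comp measurable_fst measurable_fst).
exact: (measurableT_comp measurable_fst measurable_snd).
Qed.

(** The first coordinates of two independent draws from [pi] are independent of law [mu]: the first
    marginal is used in each variable of the iterated integral. *)
Lemma product_coupling_firsts (C : set (BX * BX)) : measurable C ->
  (pi \x pi) (firsts @^-1` C) = (W2_prob mu \x W2_prob mu) C.
Proof.
move=> mC; rewrite /product_measure1 -(coupling_integral_fst cpi)/=; last 2 first.
- exact: measurable_fun_xsection.
- by move=> x; exact: measure_ge0.
apply: eq_integral => z _ /=; rewrite -(cpi.1 _ (measurable_xsection _ mC)).
rewrite /pushforward; congr (pi _); apply/seteqP; split => y /=;
  by rewrite /xsection /= !inE.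
Qed.

Lemma integral_product_firsts (C : set (BX * BX)) (h : BX * BX -> \bar R) :
  measurable C -> measurable_fun setT h -> (forall x, 0 <= h x) ->
  \int[pi \x pi]_(p in firsts @^-1` C) h (firsts p) =
    \int[W2_prob mu \x W2_prob mu]_(q in C) h q.
Proof.
move=> mC mh h0.
rewrite -(@ge0_integral_pushforward _ _ _ _ _ _ measurable_firsts (pi \x pi) C h)//.
  apply: (@eq_measure_integral _ _ _ C (W2_prob mu \x W2_prob mu)
    (mpush (pi \x pi) measurable_firsts) h) => A mA _.
  exact: product_coupling_firsts.
exact: measurable_funTS.
Qed.

End product_coupling.

(* Sorting both pairs does not increase the cost (rearrangement inequality), and
   the shift by [ep] then gains [2 ep |z1 - z2|] to first order. *)
Lemma sorted_shift_gain (R : realFieldType) (x1 x2 z1 z2 ep de : R) :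
  (0 <= ep -> `|x1 - x2| <= de ->
  (Num.max x1 x2 + ep - Num.max z1 z2) ^+ 2 +
  (Num.min x1 x2 - ep - Num.min z1 z2) ^+ 2 + 2 * ep * `|z1 - z2| <=
  (x1 - z1) ^+ 2 + (x2 - z2) ^+ 2 + 2 * ep * (de + ep))%R.
Proof.
have core a b c f : (0 <= ep -> a - b <= de -> b <= a -> f <= c ->
  (a + ep - c) ^+ 2 + (b - ep - f) ^+ 2 + 2 * ep * (c - f) <=
  (a - c) ^+ 2 + (b - f) ^+ 2 + 2 * ep * (de + ep) /\
  (a - c) ^+ 2 + (b - f) ^+ 2 <= (a - f) ^+ 2 + (b - c) ^+ 2)%R.
  move=> e0 ab1 ab2 fc; split; last by nra.
  (* After expansion the terms in c - f cancel and only this remains. *)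
  suff : (2 * ep * (a - b) <= 2 * ep * de)%R by lra.
  by rewrite ler_wpM2l// mulr_ge0.
move=> e0 xd; rewrite !maxEle !minEle.
have [x12|x21] := leP x1 x2; have [z12|z21] := leP z1 z2.
- have [|//|//|h _] := core x2 x1 z2 z1 e0.
    by move: xd; rewrite distrC ger0_norm ?subr_ge0.
  rewrite (distrC z1) (ger0_norm (_ : 0 <= z2 - z1)%R) ?subr_ge0//; lra.
- have [|//||h1 h2] := core x2 x1 z1 z2 e0; last 2 first.
  + exact: ltW.
  + rewrite (gtr0_norm (_ : 0 < z1 - z2)%R) ?subr_gt0//; lra.
  by move: xd; rewrite distrC ger0_norm ?subr_ge0.
- have [||//|h1 h2] := core x1 x2 z2 z1 e0; last 2 first.
  + exact: ltW.
  + rewrite (distrC z1) (ger0_norm (_ : 0 <= z2 - z1)%R) ?subr_ge0//; lra.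
  by move: xd; rewrite gtr0_norm ?subr_gt0.
- have [|||h1 h2] := core x1 x2 z1 z2 e0; last 3 first.
  + exact: ltW.
  + exact: ltW.
  + rewrite (gtr0_norm (_ : 0 < z1 - z2)%R) ?subr_gt0//; lra.
  by move: xd; rewrite gtr0_norm ?subr_gt0.
Qed.

Section block_coupling.
Context (R : realType) (V : countType) (Gr : metric_graph R V).
Local Notation BG := (mgborel Gr).
Local Notation d := (@mdist R (mgspace Gr)).
Context (e : edges Gr) (mu : mgW2 Gr) (K : nat) (J : (set BG)^nat) (r : R).
Context (de ep : R^nat).
Hypotheses (mJ : forall k, measurable (J k)) (tJ : trivIset setT J)
  (J_core : forall k, J k `<=` edge_core e r)
  (J_diam : forall k x y, J k x -> J k y -> (`|pos e x - pos e y| <= de k)%R)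
  (ep0 : forall k, (0 <= ep k)%R) (epr : forall k, (ep k <= r)%R).

Definition up k (q : BG * BG) : BG :=
  line e (Num.max (pos e q.1) (pos e q.2) + ep k)%R.
Definition down k (q : BG * BG) : BG :=
  line e (Num.min (pos e q.1) (pos e q.2) - ep k)%R.

Lemma measurable_up k : measurable_fun setT (up k).
Proof.
apply: (measurableT_comp (measurable_line e)); apply: measurable_funD => //.
apply: measurable_maxr.
  exact: (measurableT_comp (measurable_pos e) measurable_fst).
exact: (measurableT_comp (measurable_pos e) measurable_snd).
Qed.

Lemma measurable_down k : measurable_fun setT (down k).
Proof.
apply: (measurableT_comp (measurable_line e)); apply: measurable_funB => //.
apply: measurable_minr.
  exact: (measurableT_comp (measurable_pos e) measurable_fst).
exact: (measurableT_comp (measurable_pos e) measurable_snd).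
Qed.

Lemma weight_ge0 k : (0 <= (fine (mu (J k)) *+ 2)^-1)%R.
Proof. by rewrite invr_ge0 mulrn_wge0// fine_ge0. Qed.

(* A null block gets the weight [0^-1 = 0]. *)
Definition weight k : {nonneg R} := NngNum (weight_ge0 k).

Definition competitor_prob : probability BG R :=
  @resample_prob _ BG R mu K J weight up down mJ tJ measurable_up measurable_down
    (fun k => erefl).

(** Resampled points lie on [e], at distance at most [len e] from its origin. *)
Lemma competitor_moment :
  exists x0, \int[competitor_prob]_x ((d x0 x) ^+ 2)%:E < +oo.
Proof.
exists (org_pt e).
have mh := @measurable_sqr_mdistr R (mgspace Gr) (org_pt e).
have h0 (x : BG) : 0 <= ((d (org_pt e) x) ^+ 2)%:E by rewrite lee_fin sqr_ge0.
rewrite [ltLHS]ge0_integral_resample// lte_add_pinfty//.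
  apply: le_lt_trans (@W2_moment_lty R (mgspace Gr) mu (org_pt e)).
  apply: ge0_subset_integral => //; exact: measurable_unselected.
apply: lte_sum_pinfty => k _; rewrite lte_mul_pinfty ?lee_fin//.
apply: (@le_lt_trans _ _ (\int[W2_prob mu \x W2_prob mu]_(p in J k `*` J k)
    cst ((len e) ^+ 2 + (len e) ^+ 2)%R%:E p)).
  apply: ge0_le_integral => //.
  - exact: measurable_square.
  - by move=> p _; rewrite adde_ge0.
  - apply: measurable_funTS; apply: emeasurable_funD.
      exact: (measurableT_comp mh (measurable_up k)).
    exact: (measurableT_comp mh (measurable_down k)).
  - move=> p _; rewrite -EFinD lee_fin.
    have le_l u : (d (org_pt e) (line e u) ^+ 2 <= len e ^+ 2)%R.
      rewrite ler_pXn2r ?nnegrE ?mdist_ge0 ?len_ge0//.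
      apply: (le_trans (mdist_org_pt _)); by have /andP[] := seg_itv (clamp e u).
    by apply: lerD; exact: le_l.
rewrite integral_cst; last exact: measurable_square.
rewrite lte_mul_pinfty// ?lee_fin ?addr_ge0 ?sqr_ge0//.
rewrite [ltLHS]product_measure1E// lte_mul_pinfty//; first exact: fin_num_measure.
by rewrite -ge0_fin_numE//; exact: fin_num_measure.
Qed.

Definition competitor : mgW2 Gr := MkW2 competitor_moment.

Context (nu : mgW2 Gr) (pi : probability (BG * BG)%type R).
Hypothesis cpi : coupling mu nu pi.

Definition strip k : set (BG * BG) := fst @^-1` J k.

Lemma measurable_strip k : measurable (strip k).
Proof. by rewrite -[X in measurable X]setTI; exact: measurable_fst. Qed.

Lemma trivIset_strip : trivIset setT strip.
Proof.
apply/trivIsetP => i j _ _ ij; rewrite /strip -preimage_setI.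
by move/trivIsetP : tJ => -> //; rewrite preimage_set0.
Qed.

Definition unrolled (p : BG * BG) : R := unroll e p.1 p.2.

Lemma measurable_unrolled : measurable_fun setT unrolled.
Proof. exact: measurable_unroll. Qed.

(** The raised point goes with the second component of larger unrolled coordinate. [lo] uses the
    same test, so each second component is used exactly once, ties included. *)
Definition hi k (P : (BG * BG) * (BG * BG)) : BG * BG :=
  (up k (firsts P), if (unrolled P.2 <= unrolled P.1)%R then P.1.2 else P.2.2).

Definition lo k (P : (BG * BG) * (BG * BG)) : BG * BG :=
  (down k (firsts P), if (unrolled P.2 <= unrolled P.1)%R then P.2.2 else P.1.2).

Let m12 : measurable_fun setT (fun P : (BG * BG) * (BG * BG) => P.1.2).
Proof. exact: (measurableT_comp measurable_snd measurable_fst). Qed.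
Let m22 : measurable_fun setT (fun P : (BG * BG) * (BG * BG) => P.2.2).
Proof. exact: (measurableT_comp measurable_snd measurable_snd). Qed.
Let mle : measurable_fun setT
  (fun P : (BG * BG) * (BG * BG) => (unrolled P.2 <= unrolled P.1)%R).
Proof.
apply: measurable_fun_ler.
  exact: (measurableT_comp measurable_unrolled measurable_snd).
exact: (measurableT_comp measurable_unrolled measurable_fst).
Qed.

Lemma measurable_hi k : measurable_fun setT (hi k).
Proof.
apply: measurable_fun_pair.
  exact: (measurableT_comp (measurable_up k) (@measurable_firsts R (mgspace Gr))).
exact: measurable_fun_ifT.
Qed.

Lemma measurable_lo k : measurable_fun setT (lo k).
Proof.
apply: measurable_fun_pair.
  exact: (measurableT_comp (measurable_down k) (@measurable_firsts R (mgspace Gr))).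
exact: measurable_fun_ifT.
Qed.

Lemma pi_strip k : pi (strip k) = mu (J k).
Proof. exact: (cpi.1 _ (mJ k)). Qed.

Lemma weight_strip k : ((weight k)%:num = (fine (pi (strip k)) *+ 2)^-1)%R.
Proof. by rewrite pi_strip. Qed.

(** The resampling of the competitor lifted to [pi]. A strip has the mass of its block, so the
    weights are the same. *)
Definition sorted_coupling : probability (BG * BG)%type R :=
  @resample_prob _ (BG * BG)%type R pi K strip weight hi lo measurable_strip
    trivIset_strip measurable_hi measurable_lo weight_strip.

Lemma unselected_strip : unselected K strip = fst @^-1` unselected K J.
Proof.
by rewrite /unselected -!bigcup_mkord preimage_setC; congr (~` _).
Qed.

(** The first components of [hi] and [lo] depend only on the first coordinates of the two draws,
    which are independent of law [mu]. *)
Lemma sorted_coupling_fst (A : set BG) : measurable A ->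
  pushforward sorted_coupling fst A = competitor_prob A.
Proof.
move=> mA.
have mfA : measurable (fst @^-1` A : set (BG * BG)).
  by rewrite -[X in measurable X]setTI; exact: measurable_fst.
have m1 : measurable_fun setT (fun x : BG => (\1_A x)%:E : \bar R).
  by apply/measurable_EFinP.
have m2 : measurable_fun setT (fun z : BG * BG => (\1_A z.1)%:E : \bar R).
  exact: (measurableT_comp m1 measurable_fst).
transitivity (\int[sorted_coupling]_z (\1_A z.1)%:E).
  apply/esym; apply: etrans (integral_indic sorted_coupling measurableT mfA) _.
  by rewrite setIT.
transitivity (\int[competitor_prob]_x (\1_A x)%:E); last first.
  by rewrite integral_indic// setIT.
rewrite [LHS]ge0_integral_resample// [RHS]ge0_integral_resample//.
congr (_ + _).
  rewrite unselected_strip.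
  apply: (coupling_integral_fst_in cpi (measurable_unselected K mJ) m1).
  by move=> x; rewrite lee_fin.
apply: eq_bigr => k _; congr (_ * _).
have mq : measurable_fun setT
    (fun q : BG * BG => (\1_A (up k q))%:E + (\1_A (down k q))%:E : \bar R).
  apply: emeasurable_funD.
    exact: (measurableT_comp m1 (measurable_up k)).
  exact: (measurableT_comp m1 (measurable_down k)).
apply: (integral_product_firsts cpi (measurable_square mJ k) mq).
by move=> q; rewrite adde_ge0// lee_fin.
Qed.

(** [hi] and [lo] keep or exchange the two second components, so their contributions add up to those
    of the two draws, and the weight gives back [pi] on the strip. *)
Lemma sorted_coupling_snd (A : set BG) : measurable A ->
  pushforward sorted_coupling snd A = nu A.
Proof.
move=> mA.
have m1 : measurable_fun setT (fun x : BG => (\1_A x)%:E : \bar R).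
  by apply/measurable_EFinP.
have m2 : measurable_fun setT (fun z : BG * BG => (\1_A z.2)%:E : \bar R).
  exact: (measurableT_comp m1 measurable_snd).
have mfA : measurable (snd @^-1` A : set (BG * BG)).
  by rewrite -[X in measurable X]setTI; exact: measurable_snd.
transitivity (\int[sorted_coupling]_z (\1_A z.2)%:E).
  apply/esym; apply: etrans (integral_indic sorted_coupling measurableT mfA) _.
  by rewrite setIT.
transitivity (\int[pi]_z (\1_A z.2)%:E); last first.
  apply: etrans (integral_indic pi measurableT mfA) _.
  by rewrite setIT; exact: (cpi.2 _ mA).
rewrite [LHS]ge0_integral_resample//.
rewrite [RHS](integral_split pi K measurable_strip trivIset_strip)//.
congr (_ + _); apply: eq_bigr => k _.
rewrite -[RHS](weighted_square_sum measurable_strip weight_strip)//.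
congr (_ * _); apply: eq_integral => P _; rewrite /hi /lo /=.
by case: ifP => _//; rewrite addeC.
Qed.

Lemma sorted_coupling_coupling : coupling competitor nu sorted_coupling.
Proof. by split; [exact: sorted_coupling_fst|exact: sorted_coupling_snd]. Qed.

Lemma core_unrolled x y : edge_core e r x ->
  mdist x y = `|pos e x - unroll e x y|%R.
Proof. by move=> [[s _ ->] _]; rewrite mdist_unroll pos_pt. Qed.

Lemma core_line_unroll x y u : edge_core e r x -> (0 <= u <= len e)%R ->
  (mdist (line e u) y <= `|u - unroll e x y|)%R.
Proof.
move=> [[s _ ->] _] u0l; rewrite -[X in `|X - _|%R](line_itv u0l).
exact: mdist_le_unroll.
Qed.

(** In the core the distance equals |pos - unroll|; after a shift by at most [r] the point is still
    on [e], and the same unrolled coordinate bounds the distance from above. This reduces the claim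
    to [sorted_shift_gain] on the line. *)
Lemma sorted_gain k P : strip k P.1 -> strip k P.2 ->
  (d (hi k P).1 (hi k P).2 ^+ 2 + d (lo k P).1 (lo k P).2 ^+ 2 +
    2 * ep k * `|unrolled P.1 - unrolled P.2| <=
  d P.1.1 P.1.2 ^+ 2 + d P.2.1 P.2.2 ^+ 2 + 2 * ep k * (de k + ep k))%R.
Proof.
move=> J1 J2; have C1 := J_core J1; have C2 := J_core J2.
rewrite (core_unrolled _ C1) (core_unrolled _ C2) !real_normK ?num_real//.
have h := sorted_shift_gain (unrolled P.1) (unrolled P.2) (ep0 k) (J_diam J1 J2).
apply: le_trans h; rewrite lerD2r.
have p1 : (r <= pos e P.1.1 <= len e - r)%R by have [_] := C1; rewrite /= in_itv.
have p2 : (r <= pos e P.2.1 <= len e - r)%R by have [_] := C2; rewrite /= in_itv.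
have sq (a b : R) : (0 <= a -> a <= `|b| -> a ^+ 2 <= b ^+ 2)%R.
  move=> a0 ab; rewrite -(real_normK (num_real b)) ler_pXn2r ?nnegrE//.
have u1 : (0 <= Num.max (pos e P.1.1) (pos e P.2.1) + ep k <= len e)%R.
  by have := ep0 k; have := epr k; rewrite maxEle; case: ifP => _ *; lra.
have u2 : (0 <= Num.min (pos e P.1.1) (pos e P.2.1) - ep k <= len e)%R.
  by have := ep0 k; have := epr k; rewrite minEle; case: ifP => _ *; lra.
rewrite /hi /lo /up /down /firsts /= -/(unrolled P.1) -/(unrolled P.2).
have [z21|z12] := leP (unrolled P.2) (unrolled P.1).
  apply: lerD; apply: sq.
  - exact: mdist_ge0.
  - exact: core_line_unroll.
  - exact: mdist_ge0.
  - exact: core_line_unroll.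
apply: lerD; apply: sq.
- exact: mdist_ge0.
- exact: core_line_unroll.
- exact: mdist_ge0.
- exact: core_line_unroll.
Qed.

Definition spread k : \bar R :=
  \int[pi \x pi]_(P in strip k `*` strip k) (`|unrolled P.1 - unrolled P.2|)%:E.

Lemma sorted_coupling_cost :
  transport_cost sorted_coupling +
    \sum_(k < K) (weight k)%:num%:E * ((2 * ep k)%:E * spread k) <=
  transport_cost pi +
    \sum_(k < K) (weight k)%:num%:E *
      ((2 * ep k * (de k + ep k))%:E * (mu (J k) * mu (J k))).
Proof.
have md := measurable_sqr_mdist (@graph_denseP R V Gr).
have d0 (z : BG * BG) : 0 <= ((d z.1 z.2) ^+ 2)%:E by rewrite lee_fin sqr_ge0.
rewrite /transport_cost [X in X + _ <= _]ge0_integral_resample//.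
rewrite [X in _ <= X + _](integral_split pi K measurable_strip trivIset_strip)//.
move: (\int[pi]_(x in unselected K strip) _) => I0.
rewrite -2!addeA; apply: leeD2l; rewrite -2!big_split; apply: lee_sum => k _.
rewrite -(weighted_square_sum measurable_strip weight_strip)//.
have w0 : 0 <= (weight k)%:num%:E by rewrite lee_fin.
have mOO := measurable_square measurable_strip k.
have mhi : measurable_fun setT
    (fun P => ((d (hi k P).1 (hi k P).2) ^+ 2)%:E : \bar R).
  exact: (measurableT_comp md (measurable_hi k)).
have mlo : measurable_fun setT
    (fun P => ((d (lo k P).1 (lo k P).2) ^+ 2)%:E : \bar R).
  exact: (measurableT_comp md (measurable_lo k)).
have mspread : measurable_fun setT
    (fun P => (`|unrolled P.1 - unrolled P.2|)%:E : \bar R).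
  apply/measurable_EFinP; apply: measurableT_comp => //; apply: measurable_funB.
    exact: (measurableT_comp measurable_unrolled measurable_fst).
  exact: (measurableT_comp measurable_unrolled measurable_snd).
have md1 : measurable_fun setT
    (fun P : (BG * BG) * (BG * BG) => ((d P.1.1 P.1.2) ^+ 2)%:E : \bar R).
  exact: (measurableT_comp md measurable_fst).
have md2 : measurable_fun setT
    (fun P : (BG * BG) * (BG * BG) => ((d P.2.1 P.2.2) ^+ 2)%:E : \bar R).
  exact: (measurableT_comp md measurable_snd).
have s0 : 0 <= spread k by apply: integral_ge0 => P _; rewrite lee_fin.
have e0 : 0 <= (2 * ep k)%:E by rewrite lee_fin mulr_ge0.
(* [J_diam] makes [de k] nonnegative only when [J k] has a point; an empty block contributes
   nothing. *)
have c0 : (0 <= 2 * ep k * (de k + ep k))%R \/ J k = set0.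
  have [->|/set0P[x Jx]] := eqVneq (J k) set0; [by right|left].
  rewrite mulr_ge0// ?mulr_ge0// addr_ge0//.
  by apply: le_trans (J_diam Jx Jx); exact: normr_ge0.
case: c0 => [c0|JE]; last first.
  have OE : strip k `*` strip k = set0 by rewrite /strip JE preimage_set0 setX0.
  by rewrite /spread OE !integral_set0 JE measure0 !mule0.
have mulD (x a b a' b' : \bar R) : 0 <= x -> 0 <= a -> 0 <= b -> 0 <= a' ->
    0 <= b' -> a + b <= a' + b' -> x * a + x * b <= x * a' + x * b'.
  by move=> *; rewrite -!ge0_muleDr//; exact: lee_wpmul2l.
apply: (mulD _ _ _ _ _ w0).
- by apply: integral_ge0 => P _; rewrite adde_ge0.
- exact: (mule_ge0 e0 s0).
- by apply: integral_ge0 => P _; rewrite adde_ge0.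
- by rewrite !mule_ge0// lee_fin.
have -> : mu (J k) * mu (J k) = (pi \x pi) (strip k `*` strip k).
  rewrite [RHS]product_measure1E; [|exact: measurable_strip..].
  by rewrite -pi_strip.
rewrite /spread.
apply: (@le_integralD_cst _ _ R (pi \x pi) (strip k `*` strip k)
  (fun P => ((d (hi k P).1 (hi k P).2) ^+ 2)%:E + ((d (lo k P).1 (lo k P).2) ^+ 2)%:E)
  (fun P => (`|unrolled P.1 - unrolled P.2|)%:E)
  (fun P => ((d P.1.1 P.1.2) ^+ 2)%:E + ((d P.2.1 P.2.2) ^+ 2)%:E)
  (2 * ep k)%R (2 * ep k * (de k + ep k))%R mOO _ mspread _ _ _ _ _ c0).
- exact: emeasurable_funD.
- exact: emeasurable_funD.
- by move=> P; apply: adde_ge0.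
- by move=> P; rewrite lee_fin.
- by move=> P; apply: adde_ge0.
- by rewrite mulr_ge0.
- move=> P [h1 h2]; rewrite -EFinM -!EFinD lee_fin; exact: sorted_gain.
Qed.

End block_coupling.

(** * Concentration forced by a small mean deviation *)

Section mean_deviation.
Context d (T : measurableType d) (R : realType) (m : probability T R).
Variables (D : set T) (u : T -> R) (mD : measurable D) (mu : measurable_fun setT u).

Let dev (P : T * T) : \bar R := (`|u P.1 - u P.2|)%:E.

Let mdev : measurable_fun setT dev.
Proof.
apply/measurable_EFinP; apply: measurableT_comp => //; apply: measurable_funB.
  exact: (measurableT_comp mu measurable_fst).
exact: (measurableT_comp mu measurable_snd).
Qed.

(** If every center in [D] had mean deviation at least [c], Tonelli would give a double integral of
    at least c m(D). *)
Lemma small_deviation_center (c : R) : 0 < m D -> (0 <= c)%R ->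
  \int[m \x m]_(P in D `*` D) (`|u P.1 - u P.2|)%:E < c%:E * m D ->
  exists2 x, D x & \int[m]_(y in D) (`|u x - u y|)%:E < c%:E.
Proof.
move=> D0 c0; apply: contraPP => /forall2NP h; apply/negP; rewrite -leNgt.
have mDD : measurable (D `*` D) by exact: measurableX.
rewrite [leRHS]integral_mkcond fubini_tonelli1//; last 2 first.
- by apply/(measurable_restrictT _ mDD); exact: measurable_funTS.
- by move=> P; rewrite patchE; case: ifP => // _; rewrite lee_fin.
rewrite -integral_cst// [leLHS]integral_mkcond.
apply: le_lower_integral => x; rewrite patchE; case: ifPn => // xD; last first.
  rewrite /fubini_F; apply: integral_ge0 => y _; rewrite patchE.
  by case: ifP => // _; rewrite lee_fin.
rewrite /fubini_F [leRHS](_ : _ = \int[m]_(y in D) (`|u x - u y|)%:E).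
  by have [/(_ (set_mem xD))//|/negP] := h x; rewrite -leNgt.
rewrite [RHS]integral_mkcond; apply: eq_integral => y _.
by rewrite !patchE in_setX/= xD.
Qed.

(** By Markov, the points of [D] where [u] is [rho] or more away from [u x] carry at most half of
    the mass. *)
Lemma half_mass_near_center (x : T) (rho : R) : (0 < rho)%R ->
  \int[m]_(y in D) (`|u x - u y|)%:E <= (rho / 2)%:E * m D ->
  (2^-1)%:E * m D <= m (D `&` [set y | (`|u x - u y| < rho)%R]).
Proof.
move=> rho0 h.
have mf : measurable_fun setT (fun y => `|u x - u y|%R).
  by apply: measurableT_comp => //; exact: measurable_funB.
have := markov_ge0 m mD mf (fun y => normr_ge0 _) (ltW rho0).
move=> /le_trans/(_ h).
set far := D `&` _; set near := D `&` _.
have mfar : measurable far.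
  apply: measurableI => //; rewrite -[X in measurable X]setTI -preimage_itvcy.
  exact: mf.
have nE : near = D `\` far.
  apply/seteqP; split => [y [Dy /= yn]|y [Dy /not_andP[//|/negP]]].
    by split => // -[_ /=]; rewrite leNgt yn.
  by rewrite -ltNge.
have ffin : m far \is a fin_num by exact: fin_num_measure.
have Dfin : m D \is a fin_num by exact: fin_num_measure.
have mfD : m near = m D - m far.
  rewrite nE measureD// ?setIidr//; first by move=> y [].
  by rewrite -ge0_fin_numE//; exact: fin_num_measure.
move=> h2; have : (rho * fine (m far) <= rho * (fine (m D) / 2))%R.
  rewrite -lee_fin !EFinM !fineK//; apply: le_trans h2 _.
  by rewrite EFinM -!muleA [X in _ * X]muleC.
rewrite ler_pM2l// mfD -(fineK ffin) -(fineK Dfin) -EFinM -EFinB lee_fin /=.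
by move: (fine (m far)) (fine (m D)) => p q; lra.
Qed.

End mean_deviation.

Lemma nneseries_cutoff (R : realType) (K : nat) (f : nat -> R) :
  (forall k, (0 <= f k)%R) ->
  \sum_(i <oo) (if (i < K)%N then f i else 0)%:E = (\sum_(i < K) f i)%:E.
Proof.
move=> f0; rewrite (nneseries_split 0 K); last first.
  by move=> k _; rewrite lee_fin; case: ifP.
rewrite add0n [X in _ + X]eseries0 ?adde0.
  rewrite -sumEFin big_mkord; apply: eq_bigr => i _; by rewrite ltn_ord.
by move=> k Kk _; rewrite ltnNge Kk.
Qed.

(** * Lower bound on the spread *)

Section spread_lower_bound.
Context (R : realType) (V : countType) (Gr : metric_graph R V).
Local Notation BG := (mgborel Gr).
Context (e : edges Gr) (mu nu : mgW2 Gr) (pi : probability (BG * BG)%type R).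
Hypothesis cpi : coupling mu nu pi.
Context (K : nat) (J : (set BG)^nat) (c : R) (n : nat).
Hypotheses (mJ : forall k, measurable (J k)) (tJ : trivIset setT J).
Hypotheses (nu_org : modulus_set (mdist (org_pt e)) c n nu)
           (nu_dst : modulus_set (mdist (dst_pt e)) c n nu).
Local Notation mass k := (fine (mu (J k))).
Local Notation u := (unrolled e).

Let kappa : R := (4 * n.+1%:R)^-1%R.

(** Otherwise half of the mass of each strip has its unrolled coordinate near one center [z k], with
    radii of total at most 1 / (n + 1). The second components then lie in four sets of [nu]-measure
    at most [c], so half of the total mass is at most 4 c, against the hypothesis. *)
Lemma spread_lower_bound : (8 * c < \sum_(k < K) mass k)%R ->
  (kappa%:E <= \sum_(k < K) ((mass k)^-1 ^+ 2)%:E * spread e J pi k)%E.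
Proof.
move=> mass_big; rewrite leNgt; apply/negP => Qlt.
have [M ME] : {M : nat -> R | M = fun k => mass k} by exists (fun k => mass k).
have {}mass_big : (8 * c < \sum_(k < K) M k)%R by rewrite ME.
have {}Qlt : \sum_(k < K) ((M k)^-1 ^+ 2)%:E * spread e J pi k < kappa%:E.
  by rewrite ME.
have k0 : (0 < kappa)%R by rewrite invr_gt0 mulr_gt0.
have M0 k : (0 <= M k)%R by rewrite ME; exact: fine_ge0.
have spread0 k : 0 <= spread e J pi k.
  by apply: integral_ge0 => P _; rewrite lee_fin.
pose De k := ((M k)^-1 ^+ 2)%:E * spread e J pi k.
have De0 k : 0 <= De k by rewrite mule_ge0// lee_fin sqr_ge0.
have Defin (k : 'I_K) : De k \is a fin_num.
  rewrite ge0_fin_numE//; apply: le_lt_trans (lt_trans Qlt (ltry _)).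
  rewrite -[leRHS]/(\sum_(i < K) De i) (bigD1 k)//=.
  by apply: leeDl; apply: sume_ge0 => i _; exact: De0.
pose Dr k := fine (De k).
have Dr0 k : (0 <= Dr k)%R by exact: fine_ge0.
have Dsum : (\sum_(k < K) Dr k < kappa)%R.
  rewrite -lte_fin -sumEFin; apply: le_lt_trans Qlt.
  by apply: lee_sum => k _; rewrite fineK.
(* [tau] makes the radii positive even where [Dr k] is 0. The radii 2 (Dr k + tau) sum to at most 2
   (kappa + kappa) = 1 / (n + 1), whence the factor 4 in [kappa]. *)
pose tau : R := (kappa / K.+1%:R)%R.
have tau0 : (0 < tau)%R by rewrite divr_gt0.
pose rho k : R := (2 * (Dr k + tau))%R.
have rho0 k : (0 < rho k)%R by rewrite mulr_gt0// ltr_wpDl.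
have piE k : pi (strip J k) = mu (J k) by exact: (cpi.1 _ (mJ k)).
have muE k : mu (J k) = (M k)%:E by rewrite ME fineK//; exact: fin_num_measure.
have mO k : measurable (strip J k) by exact: measurable_strip.
have mun : measurable_fun setT u by exact: measurable_unrolled.
have center (k : 'I_K) : exists z : R, (M k / 2)%:E <=
    pi (strip J k `&` [set p | (`|z - u p| < rho k)%R]).
  have [m0|m0] := eqVneq (M k) 0%R; first by exists 0%R; rewrite m0 mul0r.
  have mp : (0 < M k)%R by rewrite lt_neqAle eq_sym m0 M0.
  have spE : spread e J pi k = (Dr k * M k ^+ 2)%:E.
    rewrite EFinM fineK// /De muleAC -EFinM -exprMn mulVf// expr1n mul1e//.
  have [|||p Op hp] := @small_deviation_center _ _ R pi (strip J k) u (mO k) mun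
    (M k * (Dr k + tau))%R.
  - by rewrite piE muE lte_fin.
  - by rewrite mulr_ge0// addr_ge0// ltW.
  - rewrite -/(spread e J pi k) spE piE muE -EFinM lte_fin.
    by rewrite expr2 mulrA ltr_pM2r// mulrC ltr_pM2l// ltrDl.
  exists (u p).
  have := @half_mass_near_center _ _ R pi (strip J k) u (mO k) mun p (rho k) (rho0 k).
  rewrite piE muE -!EFinM (mulrC 2^-1%R); apply; apply: (le_trans (ltW hp)).
  rewrite lee_fin /rho; lra.
have [zc zcP] := choice center.
pose z k : R := if insub k is Some i then zc i else 0%R.
have zP (k : 'I_K) : (M k / 2)%:E <=
    pi (strip J k `&` [set p | (`|z k - u p| < rho k)%R]).
  by rewrite /z valK; exact: zcP.
(* Past [K] the radius 0 gives empty balls. *)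
pose r k : R := if (k < K)%N then rho k else 0%R.
have r0 k : (0 <= r k)%R by rewrite /r; case: ifP => // _; exact: ltW.
have rsum : \sum_(i <oo) (r i)%:E <= ((n.+1)%:R^-1)%:E.
  rewrite nneseries_cutoff; last by move=> k; exact: ltW.
  rewrite lee_fin /rho -mulr_sumr big_split /= sumr_const card_ord.
  have t1 : (tau *+ K <= kappa)%R.
    rewrite -mulr_natr /tau -mulrA; apply: ler_piMr; first exact: ltW.
    by rewrite mulrC ler_pdivrMr// mul1r ler_nat.
  have -> : (n.+1%:R^-1 = 4 * kappa :> R)%R.
    by rewrite /kappa invfM mulrA divff// mul1r.
  by move: Dsum; lra.
(* One cover for each form of the unrolled coordinate in [unroll_cases], solved for the distance to
   an end. *)
pose C1 := mdist (org_pt e) @^-1` ball_cover z r.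
pose C2 := mdist (org_pt e) @^-1` ball_cover (fun k => - z k)%R r.
pose C3 := mdist (dst_pt e) @^-1` ball_cover (fun k => len e - z k)%R r.
pose C4 := mdist (dst_pt e) @^-1` ball_cover (fun k => z k - len e)%R r.
have mC f g : lip1 f -> measurable (f @^-1` ball_cover g r : set BG).
  move=> lf; rewrite /ball_cover preimage_bigcup.
  apply: bigcupT_measurable => i; apply: borel_dist_open.
  apply: lip1_dist_open => //; exact: ball_open.
pose S k := strip J k `&` [set p | (`|z k - u p| < rho k)%R].
have mS k : measurable (S k).
  apply: measurableI => //; rewrite -[X in measurable X]setTI.
  have mf : measurable_fun setT (fun p => `|z k - u p|%R).
    by apply: measurableT_comp => //; exact: measurable_funB.
  rewrite (_ : [set p | _] = (fun p => `|z k - u p|%R) @^-1` `]-oo, rho k[%classic).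
    exact: mf.
  by apply/seteqP; split => p; rewrite /= in_itv.
have tS : trivIset setT S.
  apply/trivIsetP => i j _ _ ij.
  have /trivIsetP/(_ i j I I ij) h := trivIset_strip tJ.
  by apply/seteqP; split => // p [[p1 _] [p2 _]]; rewrite -h.
have : (2^-1 * \sum_(k < K) M k)%:E <= pi (\big[setU/set0]_(k < K) S k).
  rewrite measure_bigsetU//.
  rewrite mulr_sumr -sumEFin; apply: lee_sum => k _; rewrite mulrC; exact: zP.
apply/negP; rewrite -ltNge.
apply: (@le_lt_trans _ _ (nu (C1 `|` C2 `|` (C3 `|` C4)))).
  rewrite -(cpi.2 _ _); last by do 2 apply: measurableU; apply: mC; exact: mdist_lip1.
  rewrite /pushforward; apply: le_measure; rewrite ?inE.
  - exact: bigsetU_measurable.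
  - rewrite -[X in measurable X]setTI; apply: measurable_snd => //.
    by do 2 apply: measurableU; apply: mC; exact: mdist_lip1.
  - rewrite -bigcup_mkord => p [k /= kK [_ /= hp]].
    have rk : r k = rho k by rewrite /r kK.
    have [uE|uE|uE|uE] := unroll_cases e p.1 p.2; rewrite /unrolled uE in hp.
    + by left; left; exists k => //; rewrite /ball/= rk.
    + left; right; exists k => //; rewrite /ball/= rk -normrN.
      by move: hp; congr (`|_| < _)%R; lra.
    + right; left; exists k => //; rewrite /ball/= rk -normrN.
      by move: hp; congr (`|_| < _)%R; lra.
    + right; right; exists k => //; rewrite /ball/= rk.
      by move: hp; congr (`|_| < _)%R; lra.
apply: (@le_lt_trans _ _ (c%:E + c%:E + (c%:E + c%:E))).
  apply: (le_trans (measureU2 _ _ _)).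
  - by apply: measurableU; apply: mC; exact: mdist_lip1.
  - by apply: measurableU; apply: mC; exact: mdist_lip1.
  - apply: leeD; (apply: (le_trans (measureU2 _ _ _));
      [by apply: mC; exact: mdist_lip1|by apply: mC; exact: mdist_lip1|]);
    apply: leeD; by [exact: nu_org|exact: nu_dst].
by rewrite -!EFinD lte_fin; lra.
Qed.

End spread_lower_bound.

(** * Comparison of the barycenter costs *)

Section lower_scaling.
Context d (T : measurableType d) (R : realType) (m : {measure set T -> \bar R}).
Import HBNNSimple.

Lemma lower_integral_leZ (k : R) (f : T -> \bar R) : (0 < k)%R ->
  (forall x, 0 <= f x) ->
  \int[m]_x (k%:E * f x) <= k%:E * \int[m]_x f x.
Proof.
move=> k0 f0; rewrite ge0_integralTE; last first.
  by move=> x; rewrite mule_ge0// lee_fin ltW.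
apply: ge_ereal_sup => _ [h hf <-]; rewrite -integralT_nnsfun.
rewrite -lee_pdivrMl// -ge0_integralZl//; last 3 first.
- exact/measurable_EFinP.
- by move=> x _; rewrite lee_fin.
- by rewrite lee_fin invr_ge0 ltW.
apply: le_lower_integral => x.
  by rewrite mule_ge0// lee_fin// invr_ge0 ltW.
by rewrite lee_pdivrMl//; exact: hf.
Qed.

End lower_scaling.

Lemma measure_bigcup_null d (T : measurableType d) (R : realType)
    (m : {measure set T -> \bar R}) (F : (set T)^nat) :
  (forall n, measurable (F n)) -> (forall n, m (F n) = 0) ->
  m (\bigcup_n F n) = 0.
Proof.
move=> mF F0; apply/eqP; rewrite eq_le measure_ge0 andbT.
have := @measure_sigma_subadditive _ _ _ m (\bigcup_n F n) F mF
  (bigcupT_measurable _ mF) (fun x h => h).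
by rewrite eseries0.
Qed.

Section barycenter_cost.
Context (R : realType) (X : pmetricType R) (D : X^nat) (Dd : dense_seq D).
Local Notation d := (@mdist R X).

(** The second moment of [P] is finite about some [nu0], and comparing moments carries this over to
    [mu]. Finite costs can later be cancelled. *)
Lemma barycenter_cost_lty (P : WW2 X) (mu : W2 d) : barycenter_cost P mu < +oo.
Proof.
have [nu0 h] := W2_moment P.
pose x0 : X := point.
have fm (m : W2 d) : \int[m]_x ((d x0 x) ^+ 2)%:E \is a fin_num.
  rewrite ge0_fin_numE ?W2_moment_lty// integral_ge0// => x _.
  by rewrite lee_fin sqr_ge0.
pose a := fine (\int[mu]_x ((d x0 x) ^+ 2)%:E).
pose b := fine (\int[nu0]_x ((d x0 x) ^+ 2)%:E).
have a0 : (0 <= a)%R by rewrite fine_ge0// integral_ge0// => x _; rewrite lee_fin sqr_ge0.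
have b0 : (0 <= b)%R by rewrite fine_ge0// integral_ge0// => x _; rewrite lee_fin sqr_ge0.
have W0 (m m' : W2 d) : 0 <= ((W2dist m m') ^+ 2)%:E by rewrite lee_fin sqr_ge0.
apply: (@le_lt_trans _ _
  (\int[P]_nu (4%:E * ((W2dist nu0 nu) ^+ 2)%:E + (2 * a + 4 * b)%:E))).
  apply: le_lower_integral => nu; first exact: W0.
  apply: (le_trans (W2dist_sq_le_moments Dd mu nu nu0 x0)).
  rewrite -(fineK (fm mu)) -(fineK (fm nu0)) -/a -/b.
  by rewrite -!(EFinD, EFinM) lee_fin; lra.
apply: (le_lt_trans (lower_integral_le_cst _ _ _)).
- by move=> nu; rewrite mule_ge0.
- by rewrite addr_ge0 ?mulr_ge0.
rewrite lte_add_pinfty ?ltry//.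
apply: (le_lt_trans (lower_integral_leZ _ _ _)) => //.
by rewrite lte_mul_pinfty.
Qed.

End barycenter_cost.

(** * Sets of measures with a uniform modulus *)

Section modulus_exhaustion.
Context (R : realType) (V : countType) (Gr : metric_graph R V).
Local Notation BG := (mgborel Gr).

Lemma modulus_set_le (f : mgspace Gr -> R) (c : R) n n' : (n <= n')%N ->
  modulus_set f c n `<=` modulus_set f c n'.
Proof.
move=> nn nu h a r r0 rs; apply: h => //; apply: le_trans rs _.
by rewrite lee_fin lef_pV2 ?posrE// ler_nat.
Qed.

Definition tame_set (e : edges Gr) (c : R) n : set (mgW2 Gr) :=
  modulus_set (mdist (org_pt e)) c n `&` modulus_set (mdist (dst_pt e)) c n.

Lemma preimage_mdist_open (v : mgspace Gr) c r :
  dist_open (@mdist R (mgspace Gr)) (mdist v @^-1` ball (c : R) r).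
Proof. by apply: lip1_dist_open; [exact: mdist_lip1|exact: ball_open]. Qed.

(** Each absolutely continuous measure is in some [tame_set], since the distances to the ends pull
    null sets back to null sets; and a countable union of sets of measure 0 has measure 0. *)
Lemma tame_set_positive (P : WW2 (mgspace Gr)) e (c : R) : (0 < c)%R ->
  0 < P (W2ac Gr) -> exists n, 0 < P (tame_set e c n).
Proof.
move=> c0 Pac; apply: contrapT => /forallNP h.
have mT n : measurable (tame_set e c n : set (borel (@W2dist R _ (@mdist R (mgspace Gr))))).
  by apply: measurableI; apply: (measurable_modulus_set (@graph_denseP R V Gr));
    exact: preimage_mdist_open.
have T0 n : P (tame_set e c n) = 0.
  by apply/eqP; rewrite eq_le measure_ge0 andbT leNgt; apply/negP; exact: h.
have : P (\bigcup_n tame_set e c n) = 0.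
  exact: measure_bigcup_null.
apply/eqP; rewrite gt_eqF//; apply: (lt_le_trans Pac); apply: le_measure.
- by rewrite inE; apply: (measurable_W2ac (@graph_denseP R V Gr)).
- by rewrite inE; exact: bigcupT_measurable.
move=> nu /null_dominates_hausdorff1P nu0.
have null v (N : set R) : measurable (mdist v @^-1` N : set BG) -> ball_null N ->
    nu (mdist v @^-1` N) = 0.
  by move=> mN N0; apply: nu0 => //; exact: ball_null_preimage_mdist.
have [n1 h1] := null_modulus_set (@preimage_mdist_open (org_pt e)) (null _) c0.
have [n2 h2] := null_modulus_set (@preimage_mdist_open (dst_pt e)) (null _) c0.
exists (maxn n1 n2) => //; split.
- by apply: modulus_set_le h1; exact: leq_maxl.
- by apply: modulus_set_le h2; exact: leq_maxr.
Qed.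

End modulus_exhaustion.

Lemma cancel_cost (R : realDomainType) (x y z : \bar R) (t k s : R) :
  x \is a fin_num -> y \is a fin_num -> z \is a fin_num -> (0 < t)%R ->
  x <= y -> y + (t * k)%:E * z <= x + (t * s)%:E -> k%:E * z <= s%:E.
Proof.
case: x => // x; case: y => // y; case: z => // z _ _ _ t0.
rewrite -!EFinM -!EFinD !lee_fin => xy h.
by rewrite -(ler_pM2l t0) mulrA; lra.
Qed.

Section competitor_gain.
Context (R : realType) (V : countType) (Gr : metric_graph R V).
Local Notation BG := (mgborel Gr).
Context (e : edges Gr) (mu : mgW2 Gr) (K : nat) (J : (set BG)^nat) (r t c : R).
Context (de ep : R^nat) (n : nat).
Hypotheses (mJ : forall k, measurable (J k)) (tJ : trivIset setT J)
  (J_core : forall k, J k `<=` edge_core e r)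
  (J_diam : forall k x y, J k x -> J k y -> (`|pos e x - pos e y| <= de k)%R)
  (ep0 : forall k, (0 <= ep k)%R) (epr : forall k, (ep k <= r)%R).
Local Notation mass k := (fine (mu (J k))).
Hypotheses (t0 : (0 <= t)%R) (de0 : forall k, (0 <= de k)%R)
  (epE : forall k, (k < K)%N -> ep k = (t / mass k)%R)
  (mass_big : (8 * c < \sum_(k < K) mass k)%R).

Local Notation mu' := (competitor e mu K ep mJ tJ).
Local Notation kappa := ((4 * n.+1%:R)^-1 : R)%R.
Local Notation eta := (\sum_(k < K) (de k + ep k))%R.

(** On a block of mass M > 0, the weight 1 / (2 M) and the shift t / M turn the gain into t spread /
    M^2 and the loss into t (de + ep). *)
Lemma competitor_transport_cost nu pi : coupling mu nu pi ->
  ((W2dist mu' nu) ^+ 2)%:E +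
    t%:E * \sum_(k < K) ((mass k)^-1 ^+ 2)%:E * spread e J pi k <=
  transport_cost pi + (t * eta)%:E.
Proof.
move=> cpi.
have h := sorted_coupling_cost K mJ tJ J_core J_diam ep0 epr cpi.
have w := W2dist_sq_le (@graph_denseP R V Gr)
  (sorted_coupling_coupling e K ep mJ tJ cpi).
have sp0 k : 0 <= spread e J pi k by apply: integral_ge0 => P _; rewrite lee_fin.
apply: (le_trans (leeD2r _ w)); apply: (le_trans _ (le_trans h _)).
  apply: leeD2l; rewrite ge0_sume_distrr; last first.
    by move=> k _; rewrite mule_ge0// lee_fin sqr_ge0.
  apply: lee_sum => k _; rewrite !muleA -!EFinM lee_wpmul2r//.
  have -> : (weight mu J k)%:num = ((mass k)^-1 / 2)%R.
    by rewrite /= -(mulr_natr (mass k)) invfM.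
  by rewrite lee_fin (epE (ltn_ord k)) expr2; lra.
apply: leeD2l; rewrite mulr_sumr -sumEFin; apply: lee_sum => k _.
have muE : mu (J k) = (mass k)%:E by rewrite fineK//; exact: fin_num_measure.
have m0 : (0 <= mass k)%R by exact: fine_ge0.
rewrite (epE (ltn_ord k)) /=; move: m0 muE; move: (fine (mu (J k))) => M m0 ->.
rewrite -!EFinM lee_fin.
have [->|M0] := eqVneq M 0%R; first by rewrite !mulr0 mulr_ge0// invr0 mulr0 addr0.
by rewrite le_eqVlt; apply/orP; left; apply/eqP; field.
Qed.

(** The bound holds for every coupling of [mu] and [nu], so the infimum can be taken. Off the tame
    set only nonnegativity of the spread is used. *)
Lemma competitor_gain nu :
  ((W2dist mu' nu) ^+ 2)%:E + (t * kappa * \1_(tame_set e c n) nu)%:E <=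
  ((W2dist mu nu) ^+ 2)%:E + (t * eta)%:E.
Proof.
rewrite -leeBlDr//; apply: (le_W2dist_sq (@graph_denseP R V Gr)) => pi cpi.
rewrite leeBlDr//; apply: le_trans (competitor_transport_cost cpi).
apply: leeD2l; rewrite -mulrA EFinM; apply: lee_wpmul2l; first by rewrite lee_fin.
rewrite indicE; case: (boolP (nu \in _)) => [/set_mem[h1 h2]|_].
  by rewrite mulr1; exact: (spread_lower_bound cpi mJ tJ h1 h2).
rewrite mulr0; apply: sume_ge0 => k _; rewrite mule_ge0 ?lee_fin ?sqr_ge0//.
by apply: integral_ge0 => P _; rewrite lee_fin.
Qed.

(* The integral of the left-hand side is superadditive although measurability
   of the squared distance is not known. *)
Lemma competitor_barycenter_gain (P : WW2 (mgspace Gr)) : barycenter P mu ->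
  (0 < t)%R -> (kappa%:E * P (tame_set e c n) <= eta%:E).
Proof.
move=> bary tp.
pose B : set (borel (@W2dist R _ (@mdist R (mgspace Gr)))) := tame_set e c n.
have mB : measurable B.
  by apply: measurableI; apply: (measurable_modulus_set (@graph_denseP R V Gr));
    exact: preimage_mdist_open.
have W0 (m m' : mgW2 Gr) : 0 <= ((W2dist m m') ^+ 2)%:E by rewrite lee_fin sqr_ge0.
have eta0 : (0 <= eta)%R by apply: sumr_ge0 => k _; rewrite addr_ge0.
have kp : (0 < kappa)%R by rewrite invr_gt0 mulr_gt0.
have tk0 : (0 <= t * kappa)%R by rewrite mulr_ge0// ltW.
have mg : measurable_fun setT (fun nu => (t * kappa * \1_B nu)%:E : \bar R).
  by apply/measurable_EFinP; apply: measurable_funM => //; exact: measurable_cst.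
have g0 nu : 0 <= (t * kappa * \1_B nu)%:E by rewrite lee_fin mulr_ge0.
have gE : \int[P]_nu (t * kappa * \1_B nu)%:E = (t * kappa)%:E * P B.
  under eq_integral do rewrite EFinM.
  rewrite ge0_integralZl//; last by apply/measurable_EFinP.
  by rewrite integral_indic// setIT.
have PBfin : P B \is a fin_num by exact: fin_num_measure.
have : barycenter_cost P mu' + (t * kappa)%:E * P B <=
    barycenter_cost P mu + (t * eta)%:E.
  rewrite -gE; apply: (le_trans (ge0_le_lower_integralD _ _ mg _)) => //.
    by rewrite gE -(fineK PBfin) -EFinM ltry.
  apply: le_trans (lower_integral_le_cst _ _ _) => //; last by rewrite mulr_ge0// ltW.
  apply: le_lower_integral => nu; first by rewrite adde_ge0.
  exact: competitor_gain.
have cfin m : barycenter_cost P m \is a fin_num.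
  rewrite ge0_fin_numE; first exact: (barycenter_cost_lty (@graph_denseP R V Gr)).
  by apply: integral_ge0 => nu _.
(* All costs are finite and [mu] is a minimizer, so the costs cancel, and division by [t] leaves the
   bound. *)
exact: cancel_cost (cfin mu) (cfin mu') PBfin tp (bary mu').
Qed.

End competitor_gain.

(** * Absolute continuity inside the edges *)

Section edge_null.
Context (R : realType) (V : countType) (Gr : metric_graph R V).
Local Notation BG := (mgborel Gr).
Context (P : WW2 (mgspace Gr)) (P_ac : 0 < P (W2ac Gr)).
Context (mu : mgW2 Gr) (mu_bary : barycenter P mu).

(** Were mu(A) positive, a fine cover of [A] followed by small enough shifts would violate the bound
    of [competitor_barycenter_gain]. *)
Lemma barycenter_core_null e (r : R) (A : set BG) : (0 < r)%R ->
  measurable A -> A `<=` edge_core e r -> @ball_null R (mgspace Gr) A -> mu A = 0.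
Proof.
move=> r0 mA Acore A0; apply/eqP; rewrite eq_le measure_ge0 andbT leNgt.
apply/negP => muA0.
have muAfin : mu A \is a fin_num by exact: fin_num_measure.
pose m := fine (mu A).
have mE : mu A = m%:E by rewrite fineK.
have m0 : (0 < m)%R by rewrite -lte_fin -mE.
(* 8 m / 20 is below m / 2, a mass that finitely many blocks exceed. *)
have c0 : (0 < m / 20)%R by rewrite divr_gt0.
have [n Pn] := tame_set_positive e c0 P_ac.
pose kappa : R := (4 * n.+1%:R)^-1%R.
have kappa0 : (0 < kappa)%R by rewrite invr_gt0 mulr_gt0.
have Pfin : P (tame_set e (m / 20) n) \is a fin_num.
  apply: fin_num_measure; apply: measurableI;
    apply: (measurable_modulus_set (@graph_denseP R V Gr));
    exact: preimage_mdist_open.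
pose p := fine (P (tame_set e (m / 20) n)).
have pE : P (tame_set e (m / 20) n) = p%:E by rewrite fineK.
have p0 : (0 < p)%R by rewrite -lte_fin -pE.
pose q : R := (kappa * p)%R.
have q0 : (0 < q)%R by rewrite mulr_gt0.
(* Below r / 2, so that the pieces are short enough for [edge_core_isometry]; and 3 [sz], the final
   bound on diameters and shifts together, is below [q]. *)
pose sz : R := (Num.min q r / 8)%R.
have sz0 : (0 < sz)%R by rewrite divr_gt0// lt_min q0 r0.
have szr : (2 * sz < r)%R.
  have : (Num.min q r <= r)%R by rewrite ge_min lexx orbT.
  rewrite /sz; lra.
have szq : (8 * sz <= q)%R.
  have : (Num.min q r <= q)%R by rewrite ge_min lexx.
  rewrite /sz; lra.
have [a [rho [rho0 rhos Aa]]] := A0 _ sz0.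
have rhosz i : (rho i <= sz)%R.
  rewrite -lee_fin; apply: le_trans rhos.
  rewrite (@nneseriesD1 _ (fun i => (rho i)%:E) i)//; last by move=> k _; rewrite lee_fin.
  by rewrite leeDl// nneseries_ge0// => k _ _; rewrite lee_fin.
pose I0 k : set BG := A `&` ball (a k) (rho k).
have mI0 k : measurable (I0 k) by apply: measurableI => //; exact: borel_ball.
pose J k : set BG := seqDU I0 k.
have mJ k : measurable (J k).
  by apply: measurableD => //; exact: bigsetU_measurable.
have tJ : trivIset setT J by exact: trivIset_seqDU.
have JI k : J k `<=` I0 k by exact: subDsetl.
have J_core k : J k `<=` edge_core e r by move=> x /JI[/Acore].
have J_diam k x y : J k x -> J k y -> (`|pos e x - pos e y| <= 2 * rho k)%R.
  move=> Jx Jy; have [Ax xa] := JI _ _ Jx; have [Ay ya] := JI _ _ Jy.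
  rewrite ballEmdist /= in xa ya.
  have h := @metric_triangle _ (mgspace Gr) x (a k) y.
  rewrite (@metric_sym _ (mgspace Gr) x (a k)) in h.
  have hr := rhosz k.
  rewrite -(edge_core_isometry (Acore _ Ax) (Acore _ Ay)).
    move: h xa ya; lra.
  move: h xa ya; lra.
have AJ : A = \bigcup_k J k.
  rewrite -seqDU_bigcup_eq; apply/seteqP; split => [x Ax|x [k _ []//]].
  by have [k _ xk] := Aa _ Ax; exists k => //; split.
have [K massK] : exists K, (m / 2 < \sum_(k < K) fine (mu (J k)))%R.
  have cvgJ : (fun K => \sum_(0 <= k < K) mu (J k)) @ \oo --> m%:E.
    rewrite -mE {1}AJ; apply: measure_semi_sigma_additive => //.
    exact: bigcupT_measurable.
  apply: contrapT => /forallNP h.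
  have : m%:E <= (m / 2)%:E.
    rewrite -(cvg_lim _ cvgJ)//; apply: lime_le.
      by apply/cvg_ex; exists m%:E.
    apply: nearW => K; rewrite big_mkord.
    have /negP := h K; rewrite -leNgt -lee_fin; apply: le_trans.
    rewrite -sumEFin; apply: lee_sum => k _; rewrite fineK//.
    exact: fin_num_measure.
  by rewrite lee_fin; lra.
pose M k := fine (mu (J k)).
have M0 k : (0 <= M k)%R by exact: fine_ge0.
pose S := (\sum_(k < K) (M k)^-1)%R.
have S0 : (0 <= S)%R by apply: sumr_ge0 => k _; rewrite invr_ge0.
(* Makes the shifts t / M k sum to at most [sz]; adding 1 keeps the denominator positive. *)
pose t := (sz / (S + 1))%R.
have t0 : (0 < t)%R by rewrite divr_gt0// ltr_wpDl.
have tS : (t * S <= sz)%R.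
  rewrite /t mulrAC ler_pdivrMr ?ltr_wpDl// ler_wpM2l ?ltW//; lra.
pose ep k := if (k < K)%N then (t / M k)%R else 0%R.
have ep0 k : (0 <= ep k)%R.
  by rewrite /ep; case: ifP => // _; rewrite divr_ge0// ltW.
have epr k : (ep k <= r)%R.
  rewrite /ep; case: ifPn => kK; last exact: ltW.
  apply: (@le_trans _ _ (t * S)%R); last by lra.
  apply: ler_wpM2l; first exact: ltW.
  rewrite /S (bigD1 (Ordinal kK))//= lerDl sumr_ge0// => i _.
  by rewrite invr_ge0.
have epE k : (k < K)%N -> ep k = (t / M k)%R by rewrite /ep => ->.
have de0 k : (0 <= 2 * rho k)%R by rewrite mulr_ge0.
have mass_big : (8 * (m / 20) < \sum_(k < K) fine (mu (J k)))%R.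
  by apply: lt_trans massK; lra.
have := competitor_barycenter_gain n mJ tJ J_core J_diam ep0 epr (ltW t0) de0 epE
  mass_big mu_bary t0.
apply/negP; rewrite -ltNge pE -EFinM lte_fin -/kappa -/q big_split /= -mulr_sumr.
have h1 : (\sum_(k < K) rho k <= sz)%R.
  rewrite -lee_fin -sumEFin; apply: le_trans rhos.
  rewrite -(big_mkord xpredT (fun k => (rho k)%:E)).
  by apply: nneseries_lim_ge => k _; rewrite lee_fin.
have h2 : (\sum_(k < K) ep k <= sz)%R.
  apply: le_trans tS; rewrite /S mulr_sumr; apply: ler_sum => k _.
  by rewrite epE.
lra.
Qed.


Lemma barycenter_interior_null e (A : set BG) :
  measurable A -> @ball_null R (mgspace Gr) A -> mu (A `&` edge_interior e) = 0.
Proof.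
move=> mA A0; rewrite edge_interior_bigcup_core setI_bigcupr.
apply: measure_bigcup_null => n.
  by apply: measurableI => //; exact: measurable_edge_core.
apply: (@barycenter_core_null e (n.+1%:R^-1)%R) => //.
- by apply: measurableI => //; exact: measurable_edge_core.
- by apply: sub_ball_null A0; exact: subIsetl.
Qed.

End edge_null.

(** * Vertices and interiors of edges *)

Section vertices.
Context (R : realType) (V : countType) (Gr : metric_graph R V).
Local Notation G := (mgspace Gr).
Local Notation BG := (mgborel Gr).

Definition nth_interior n : set BG :=
  if nth_edge Gr n is Some e then edge_interior e else set0.

Lemma measurable_nth_interior n : measurable (nth_interior n).
Proof.
by rewrite /nth_interior; case: nth_edge => // e; exact: edge_interior_measurable.
Qed.

Lemma verticesE : vertices Gr = \bigcup_e [set org_pt e; dst_pt e].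
Proof.
apply/seteqP; split => [_ [[e s] vs ->]|x [e _ [->|->]]].
- exists e => //; move: vs; case: at_vertexP => //= sc _.
  + by left; congr (\pi_(mgspace Gr) _)%qT; congr existT; apply: val_inj.
  + by right; congr (\pi_(mgspace Gr) _)%qT; congr existT; apply: val_inj.
- by exists (Tagged _ (seg0 e)); rewrite ?at_vertex0.
- by exists (Tagged _ (segl e)); rewrite ?at_vertexl.
Qed.

Lemma verticesC : ~` vertices Gr = \bigcup_n nth_interior n.
Proof.
apply/seteqP; split => x.
- have [e [s ->]] := ptP x => sv; have [n ne] := nth_edgeP e.
  exists n => //; rewrite /nth_interior ne; exists s => //.
  have : ~ at_vertex (Tagged _ s).
    by move=> vs; apply: sv; exists (Tagged _ s).
  by case: (at_vertexP (Tagged _ s)).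
- rewrite /nth_interior => -[n _]; case: nth_edge => // e [s sl ->] [p vp].
  move=> /eqmodP; rewrite /= /Defs.glue => /orP[/eqP sp|/andP[+ _]].
    move: vp; rewrite -sp; case: (at_vertexP (Tagged _ s)) => // sc.
      by move: sl; rewrite -[val s]/(position (Tagged _ s)) sc ltxx.
    by move: sl; rewrite -[val s]/(position (Tagged _ s)) sc ltxx andbF.
  case: (at_vertexP (Tagged _ s)) => // sc.
    by move: sl; rewrite -[val s]/(position (Tagged _ s)) sc ltxx.
  by move: sl; rewrite -[val s]/(position (Tagged _ s)) sc ltxx andbF.
Qed.

Lemma measurable_vertices : measurable (vertices Gr : set BG).
Proof.
rewrite -[vertices _]setCK verticesC; apply: measurableC.
exact: bigcupT_measurable measurable_nth_interior.
Qed.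

Lemma ball_null_vertices : @ball_null R G (vertices Gr).
Proof.
rewrite verticesE; apply: ball_null_edges => e eta eta0.
exists (fun i => if i is 0%N then org_pt e else dst_pt e).
exists (fun i => (eta / (2 ^ i.+1)%:R)%R); split.
- by move=> i; rewrite divr_ge0// ltW.
- by apply: sum_halves; exact: ltW.
- have p i : (0 < eta / (2 ^ i.+1)%:R)%R by rewrite divr_gt0// ltr0n expn_gt0.
  move=> x [->|->]; first by exists 0%N => //; rewrite ballEmdist /= mdistxx.
  by exists 1%N => //; rewrite ballEmdist /= mdistxx.
Qed.

Lemma countable_vertices : countable (vertices Gr).
Proof.
pose F n : set G := if nth_edge Gr n is Some e then [set org_pt e; dst_pt e] else set0.
apply: (@sub_countable _ _ _ (\bigcup_n F n)).
  apply: subset_card_le; rewrite verticesE => x [e _ ex].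
  by have [n ne] := nth_edgeP e; exists n => //; rewrite /F ne.
apply: bigcup_countable => // n _; rewrite /F; case: nth_edge => [e|//].
by apply: finite_set_countable; rewrite finite_setU.
Qed.

Lemma measurable_point (x : G) : measurable ([set x] : set BG).
Proof.
rewrite -[[set x]]setCK; apply: measurableC; apply: borel_dist_open => y yx.
exists (mdist y x); first by rewrite mdist_gt0; apply/eqP.
by move=> z + zx; rewrite zx ltxx.
Qed.

End vertices.

(** An injection into [nat] cuts [S] into sets of at most one point, whose traces on [A] are
    measurable, and sigma-additivity applies. *)
Lemma measure_countable_esum d (T : measurableType d) (R : realType)
    (m : {measure set T -> \bar R}) (S A : set T) :
  countable S -> (forall x : T, measurable [set x]) ->
  m (A `&` S) = \esum_(x in S) m (A `&` [set x]).
Proof.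
move=> /countable_injP[f finj] mx.
pose Sn n := S `&` [set x | f x = n].
have SE : S = \bigcup_n Sn n.
  by apply/seteqP; split => [x Sx|x [n _ []//]]; exists (f x).
have Sn1 n : Sn n = set0 \/ exists2 x, S x & Sn n = [set x].
  have [->|/set0P[x [Sx xn]]] := eqVneq (Sn n) set0; [by left|right].
  exists x => //; apply/seteqP; split => [y [Sy yn]|y ->]; last by split.
  by apply: finj; rewrite ?inE//; rewrite -xn in yn.
have tSn : trivIset setT Sn.
  apply/trivIsetP => i j _ _ /eqP ij; apply/seteqP; split => // x [[_ xi] [_ xj]].
  by apply: ij; rewrite -xi -xj.
have mAS n : measurable (A `&` Sn n).
  have [->|[x Sx ->]] := Sn1 n; first by rewrite setI0.
  have [Ax|nAx] := pselect (A x).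
    by rewrite setIC (_ : _ `&` A = [set x])//; apply/setIidPl => y ->.
  by rewrite (_ : A `&` _ = set0)//; apply/seteqP; split => // y [Ay yx]; apply: nAx; rewrite -yx.
have m0 x : 0 <= m (A `&` [set x]) by exact: measure_ge0.
rewrite {1}SE setI_bigcupr measure_bigcup//; last first.
  by apply: trivIset_setIl.
rewrite nneseries_esum// [X in \esum_(_ in X) _](_ : _ = setT); last first.
  by apply/seteqP; split => // n _ /=; rewrite inE.
rewrite [in RHS]SE esum_bigcupT//.
apply: eq_esum => n _; have [->|[x Sx ->]] := Sn1 n.
  by rewrite setI0 measure0 esum_set0.
by rewrite esum_set1.
Qed.

(** * Singular parts are carried by the vertices *)

Section singular_parts.
Context (R : realType) (V : countType) (Gr : metric_graph R V).
Local Notation BG := (mgborel Gr).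
Context (mu : mgW2 Gr).
Hypothesis interior_null : forall e (A : set BG), measurable A ->
  @ball_null R (mgspace Gr) A -> mu (A `&` edge_interior e) = 0.

Let off_vertices : measurable (~` vertices Gr : set BG).
Proof. by apply: measurableC; exact: measurable_vertices. Qed.

Lemma off_vertices_null (A : set BG) : measurable A ->
  @ball_null R (mgspace Gr) A -> mu (A `&` ~` vertices Gr) = 0.
Proof.
move=> mA A0; rewrite verticesC setI_bigcupr; apply: measure_bigcup_null => n.
  by apply: measurableI => //; exact: measurable_nth_interior.
by rewrite /nth_interior; case: nth_edge => [e|]; [exact: interior_null|rewrite setI0].
Qed.

(** The restriction of [mu] off the vertices charges no null set, and the vertices themselves form a
    null set. *)
Lemma singular_part_vertices :
  singular_part (mgH Gr) mu (mrestr mu (@measurable_vertices R V Gr)).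
Proof.
exists (mrestr mu off_vertices); split.
- by apply/null_dominates_hausdorff1P; exact: off_vertices_null.
- exists (vertices Gr); split; first exact: measurable_vertices.
    by apply: ball_null_hausdorff1; exact: ball_null_vertices.
  by change (mu (~` vertices Gr `&` vertices Gr) = 0); rewrite setICl measure0.
- move=> A mA; have mV := @measurable_vertices R V Gr.
  change (mu A = mu (A `&` ~` vertices Gr) + mu (A `&` vertices Gr)).
  rewrite -measureU//; [|exact: measurableI..|]; last first.
    by rewrite setIACA setICl setI0.
  by rewrite -setIUr setUC setUv setIT.
Qed.

(** Any such [ms] is below [mu], which vanishes on null sets off the vertices, and is carried by a
    null set [N]. So it is carried by the countable set of vertices and is the sum of its atoms. *)
Lemma singular_part_esum (ms : {measure set BG -> \bar R}) :
  singular_part (mgH Gr) mu ms ->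
  exists w : mgspace Gr -> R, (forall x, (0 <= w x)%R) /\
    (forall A : set BG, measurable A ->
       ms A = \esum_(x in vertices Gr) ((w x)%:E * \d_(x : BG) A)).
Proof.
move=> [ma [_ [N [mN N0 msN]] muE]].
have ms_mu A : measurable A -> ms A <= mu A.
  by move=> mA; rewrite muE// leeDr.
have msfin A : measurable A -> ms A \is a fin_num.
  move=> mA; rewrite ge0_fin_numE//; apply: (le_lt_trans (ms_mu A mA)).
  by rewrite -ge0_fin_numE//; exact: fin_num_measure.
have mp (x : BG) : measurable [set x] by exact: measurable_point.
have N0' : @ball_null R (mgspace Gr) N by exact: hausdorff1_ball_null.
have ms_off : ms (~` vertices Gr) = 0.
  apply/eqP; rewrite eq_le measure_ge0 andbT.
  have -> : ~` vertices Gr = (N `&` ~` vertices Gr) `|` (~` N `&` ~` vertices Gr).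
    by rewrite -setIUl setUv setTI.
  have m1 : measurable (N `&` ~` vertices Gr : set BG) by exact: measurableI.
  have m2 : measurable (~` N `&` ~` vertices Gr : set BG).
    by apply: measurableI => //; exact: measurableC.
  apply: (le_trans (measureU2 _ m1 m2)).
  rewrite -[leRHS]adde0; apply: leeD.
    by rewrite -(off_vertices_null mN N0'); exact: ms_mu.
  rewrite -msN; apply: le_measure; rewrite ?inE//; exact: measurableC.
exists (fun x => fine (ms [set x])); split; first by move=> x; exact: fine_ge0.
move=> A mA; have mV := @measurable_vertices R V Gr.
transitivity (ms (A `&` vertices Gr)).
  rewrite -{1}(setIT A) -(setUv (vertices Gr)) setIUr measureU//.
  - rewrite [X in _ + X = _](_ : _ = 0) ?adde0//.
    apply: (subset_measure0 _ _ _ ms_off) => //; first exact: measurableI.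
  - exact: measurableI.
  - exact: measurableI.
  - by rewrite setIACA setICr setI0.
rewrite measure_countable_esum//; last exact: countable_vertices.
apply: eq_esum => x _; rewrite fineK; last exact: msfin.
have [Ax|nAx] := pselect (A x).
  rewrite diracE mem_set// mule1; congr (ms _).
  by apply/seteqP; split => [y []//|y ->].
rewrite diracE memNset// mule0 (_ : A `&` _ = set0) ?measure0//.
by apply/seteqP; split => // y [Ay yx]; apply: nAx; rewrite -yx.
Qed.

End singular_parts.

Theorem theorem1p1 (R : realType) (V : countType) (Gr : metric_graph R V)
    (P : WW2 (mgspace Gr)) (P_ac : 0 < P (W2ac Gr))
    (mu : mgW2 Gr) (mu_bary : barycenter P mu) :
  (forall e : edges Gr, mrestr mu (edge_interior_measurable e) `<< mgH Gr) /\
  (~ (mu `<< mgH Gr) ->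
   (exists ms : {measure set (mgborel Gr) -> \bar R},
      singular_part (mgH Gr) mu ms) /\
   (forall ms : {measure set (mgborel Gr) -> \bar R},
      singular_part (mgH Gr) mu ms ->
      exists w : mgspace Gr -> R,
        (forall x, (0 <= w x)%R) /\
        (forall A : set (mgborel Gr), measurable A ->
           ms A = \esum_(x in vertices Gr)
                    ((w x)%:E * \d_(x : mgborel Gr) A)))).
Proof.
have null := barycenter_interior_null P_ac mu_bary.
split=> [e|_].
  by apply/null_dominates_hausdorff1P => A mA A0; exact: null.
split; first by eexists; exact: singular_part_vertices null.
by move=> ms; exact: singular_part_esum.
Qed.
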